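(* For every forest $H$ there exists $\epsilon>0$ such that for every graph $G$ with $|G|>1$ that does not contain $H$, either \begin{itemize} \item some vertex of $G$ has degree at least $\epsilon |G|$; or \item there exist disjoint sets $A,B\subseteq V(G)$ with $|A|,|B|\ge \epsilon |G|$ such that $A$ is anticomplete to $B$. \end{itemize} Equivalently: for every forest $H$ there exists $\epsilon>0$ such that every $\epsilon$-coherent graph contains $H$.
   Context: All graphs are finite, without loops or parallel edges; $|G|$ denotes the number of vertices of $G$. A graph $G$ contains $H$ if some induced subgraph of $G$ is isomorphic to $H$. Disjoint sets $A,B$ of vertices are anticomplete if no vertex of $A$ has a neighbour in $B$. For $\epsilon>0$, a graph $G$ is $\epsilon$-coherent if $|G|>1$, every vertex has degree less than $\epsilon|G|$, and there do not exist disjoint anticomplete sets $A,B\subseteq V(G)$ with $|A|,|B|\ge \epsilon|G|$. *)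

(* Defs.v *)
From HB Require Import structures.
From mathcomp Require Import all_boot all_order all_algebra.
Set Implicit Arguments. Unset Strict Implicit. Unset Printing Implicit Defensive.
Import Order.TTheory GRing.Theory Num.Theory.

Definition simple_graph (T : finType) (e : rel T) : Prop :=
  symmetric e /\ irreflexive e.

Definition forest (T : finType) (e : rel T) : Prop :=
  forall c : seq T, uniq c -> 3 <= size c -> ~~ cycle e c.

Definition contains (TG : finType) (eG : rel TG) (TH : finType) (eH : rel TH) : Prop :=
  exists f : TH -> TG, injective f /\ forall x y, eG (f x) (f y) = eH x y.

Definition degree (T : finType) (e : rel T) (x : T) : nat := #|[set y | e x y]|.

Definition anticomplete (T : finType) (e : rel T) (A B : {set T}) : Prop :=
  [disjoint A & B] /\ forall a b, a \in A -> b \in B -> ~~ e a b.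

(* Main.v *)
(** Every forest on [h] vertices is an induced subgraph of the binomial tree of
rank [h], so it is enough to find binomial trees.  Assume counterexamples for
[eps = 1 / (n + 1)] exist for all [n] and fix an ultrafilter on [nat]: along it
degrees become infinitesimal, and two disjoint sets of non-infinitesimal measure
are never anticomplete.  A hit on a root set [M] is a set [X] whose vertices
carry an induced tree of rank [k], together with a map sending every vertex of
[M] to a neighbour in [X]; [k + 1] pairwise anticomplete hits of rank [k] make
every vertex of [M] carry a tree of rank [k + 1].  Growing a subset of one set
greedily until its neighbourhood covers a definite part of one of several
targets turns sets carrying trees into hits on other sets.  By downward
induction on [k] one shows that many hits of rank [k] on [M] yield any number of
hits of rank [k + 1] on a set [Q] disjoint from [M]; iterating from [k = 0]
produces a tree of rank [h]. *)

From HB Require Import structures.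
From mathcomp Require Import all_boot all_order all_algebra zify boolp.
From mathcomp Require filter.
Require Import Defs.
Set Implicit Arguments. Unset Strict Implicit. Unset Printing Implicit Defensive.
Import Order.TTheory GRing.Theory Num.Theory.

(** * Weighted finite sets and greedy growth *)

(** Which target a growth process hits cannot be prescribed, and the proof is built around this lack
    of control. Each induction step is a game with bounded counters: either [Q] gains a hit, or some
    other set does, and a set that has collected enough is handled by the statement for rank
    [k + 1]. Hence the induction runs downward, from a rank where no tree exists and everything is
    vacuous. Two statements are carried together: promotion starts from hits on one root set,
    gathering from many mutually separated sets that carry trees. They meet in a dichotomy for a hit
    with assignment [f]. If any two large parts of the root set shrink so that the image of one
    avoids the other, the hit can be shared out among blocks; otherwise some measure on it dominates
    a large part of the root set, so it can itself receive hits and pass them back. Assignments must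
    be sparse so that the image measure on a hit has no concentration, as a source for growth
    requires. The ultrafilter replaces nested thresholds by the single notion of an infinitesimal
    part. *)

Section FiniteWeights.
Variables (T : finType) (r : rel T).
Hypotheses (rr : reflexive r) (rs : symmetric r).
Implicit Types (A B Y : {set T}) (w : T -> nat) (g : T -> T).

Definition wt w A := \sum_(x in A) w x.
Definition nb A := [set y | [exists x in A, r x y]].

Lemma nbP A y : reflect (exists2 x, x \in A & r x y) (y \in nb A).
Proof. by rewrite inE; apply: (iffP exists_inP). Qed.

Lemma in_nb1 x y : (y \in nb [set x]) = r x y.
Proof.
apply/nbP/idP => [[z /set1P->] //|rxy]; by exists x; rewrite ?set11.
Qed.

Lemma nbU A B : nb (A :|: B) = nb A :|: nb B.
Proof.
apply/setP=> y; rewrite !inE; apply/exists_inP/orP.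
  by case=> x; rewrite inE => /orP[] xA rxy; [left|right]; apply/exists_inP; exists x.
by case=> /exists_inP[x xA rxy]; exists x => //; rewrite inE xA ?orbT.
Qed.

Lemma nbS A B : A \subset B -> nb A \subset nb B.
Proof.
by move=> sAB; apply/subsetP=> y /nbP[x xA rxy]; apply/nbP; exists x => //; apply: (subsetP sAB).
Qed.

Lemma wtS w A B : A \subset B -> wt w A <= wt w B.
Proof.
move=> sAB; rewrite /wt [leqRHS](big_setID A) /= (setIidPr sAB); exact: leq_addr.
Qed.

Lemma wtID w A B : wt w A = wt w (A :&: B) + wt w (A :\: B).
Proof. exact: big_setID. Qed.

Lemma wtU w A B : wt w (A :|: B) <= wt w A + wt w B.
Proof.
rewrite (wtID w (A :|: B) A) setUK leq_add2l; apply: wtS.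
by rewrite setDUl setDv set0U subsetDl.
Qed.

Lemma wt_indic w A (P : pred T) : wt w (A :&: [set x | P x]) = \sum_(x in A) w x * P x.
Proof.
rewrite /wt [RHS](big_setID [set x | P x]) /= [X in _ = _ + X]big1 ?addn0 => [|x].
  by apply: eq_bigr => x; rewrite !inE => /andP[_ ->]; rewrite muln1.
by rewrite !inE => /andP[/negPf-> _]; rewrite muln0.
Qed.

Lemma wt_bigcup_le w (m : nat) (B : nat -> {set T}) :
  wt w (\bigcup_(i < m) B i) <= \sum_(i < m) wt w (B i).
Proof.
elim: m => [|m IH]; first by rewrite !big_ord0 /wt big_set0.
by rewrite !big_ord_recr /=; apply: leq_trans (wtU _ _ _) _; rewrite leq_add2r.
Qed.

Section Grow.
Variables (A : {set T}) (w : T -> nat) (m : nat) (D : nat -> {set T}) (rho : nat -> T -> nat).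
Variables (k k0 : nat).
Let t i := wt (rho i) (D i).
Hypotheses (k8 : 8 <= k) (k0k : k0 <= k) (m_gt0 : 0 < m).
Hypothesis tpos : forall i, i < m -> 0 < t i.
Hypothesis small_step :
  forall i y, i < m -> y \in A -> k * wt (rho i) (nb [set y] :&: D i) <= t i.
Hypothesis small_source :
  forall y, y \in A -> m * (k * k) * wt w (nb [set y] :&: A) <= wt w A.
Hypothesis covering : forall A', A' \subset A ->
  k0 * wt w (A :\: A') <= wt w A -> t 0 < 2 * wt (rho 0) (nb A' :&: D 0).

(* [g] assigns to each vertex of the neighbourhood of [Y] a neighbour in [Y]; keeping [pairs] small
   is what makes the final assignment sparse. *)
Let pairs i Y g :=
  \sum_(x in nb Y :&: D i) \sum_(x' in nb Y :&: D i) rho i x * rho i x' * r (g x) (g x').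

Let inv Y g := [/\ Y \subset A, forall x, x \in nb Y -> g x \in Y /\ r x (g x)
  & forall i, i < m -> k * pairs i Y g <= 3 * t i * wt (rho i) (nb Y :&: D i)].

Let bad i Y g := [set y in A | t i < k * wt (rho i) (nb Y :&: D i :&: [set x | r (g x) y])].

(** Double counting of adjacent pairs between [A] and the assigned vertices: each [g x] lies in [A],
    so it sees at most a [1/(m k^2)] part of [A]. One factor [k] is spent on the threshold in [bad],
    the other remains. *)
Lemma bad_small i Y g : inv Y g -> i < m -> m * k * wt w (bad i Y g) <= wt w A.
Proof.
case=> sYA gY _ im.
have ti := tpos im.
set E := nb Y :&: D i.
have S1 : t i * wt w (bad i Y g) <= k * \sum_(y in A) w y * \sum_(x in E) rho i x * r (g x) y.
  rewrite !big_distrr /= [leqRHS](big_setID (bad i Y g)) /=.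
  have -> : A :&: bad i Y g = bad i Y g.
    by apply/setP=> y; rewrite !inE; case: (y \in A).
  apply: leq_trans (leq_addr _ _); apply: leq_sum => y.
  rewrite inE => /andP[yA]; rewrite wt_indic => /ltnW h.
  by rewrite [k * _]mulnCA [t i * _]mulnC leq_mul2l h orbT.
have S2 : m * (k * k) * (\sum_(y in A) w y * \sum_(x in E) rho i x * r (g x) y) <= t i * wt w A.
  have -> : \sum_(y in A) w y * \sum_(x in E) rho i x * r (g x) y
          = \sum_(x in E) rho i x * wt w (nb [set g x] :&: A).
    under eq_bigr do rewrite big_distrr /=.
    rewrite exchange_big /=; apply: eq_bigr => x _.
    have -> : nb [set g x] :&: A = A :&: [set y | r (g x) y].
      by apply/setP=> y; rewrite !inE -in_nb1 /nb !inE andbC.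
    rewrite wt_indic big_distrr /=; apply: eq_bigr => y _; lia.
  rewrite big_distrr /=.
  apply: (@leq_trans (\sum_(x in E) rho i x * wt w A)).
    apply: leq_sum => x; rewrite inE => /andP[xY _].
    have [gxY _] := gY _ xY.
    by rewrite mulnCA leq_mul2l small_source ?orbT // (subsetP sYA).
  rewrite -big_distrl /= leq_mul2r; apply/orP; right; apply: wtS; exact: subsetIr.
move: S1 S2; set b := wt w _; set s := \sum_(y in A) _ => S1 S2.
have : t i * (m * k * b) <= t i * wt w A.
  rewrite mulnCA; apply: (@leq_trans (m * k * (k * s))); first by rewrite leq_mul2l S1 orbT.
  by apply: leq_trans S2; rewrite -!mulnA.
by rewrite leq_mul2l; case/orP=> // /eqP t0; rewrite t0 in ti.
Qed.

(** A vertex outside all bad sets raises [pairs] by [2 b F + F^2], where [b] and the newly covered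
    weight [F] are at most [t i / k]; hence the factor 3 in [inv]. The covered part stays below
    [t i / 4 + t i / 8]. *)
Lemma grow_step Y g : inv Y g -> (forall i, i < m -> 4 * wt (rho i) (nb Y :&: D i) < t i) ->
  exists Y' g', [/\ inv Y' g', #|~: nb Y'| < #|~: nb Y|
    & forall i, i < m -> 2 * wt (rho i) (nb Y' :&: D i) <= t i].
Proof.
move=> iY low; case: (iY) => sYA gY pY.
set B := \bigcup_(i < m) bad i Y g.
have Bs : k * wt w B <= wt w A.
  have h : m * (k * wt w B) <= m * wt w A.
    apply: (@leq_trans (\sum_(i < m) m * k * wt w (bad i Y g))).
      rewrite -big_distrr /= -!mulnA !leq_mul2l; apply/orP; right; apply/orP; right.
      exact: (@wt_bigcup_le w m (fun i => bad i Y g)).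
    apply: (@leq_trans (\sum_(i < m) wt w A)).
      by apply: leq_sum => i _; apply: bad_small.
    by rewrite sum_nat_const card_ord.
  by move: h; rewrite leq_mul2l; case/orP=> // /eqP m0; move: m_gt0; rewrite m0.
have sA' : A :\: B \subset A by exact: subsetDl.
have hB : k0 * wt w (A :\: (A :\: B)) <= wt w A.
  apply: leq_trans Bs; apply: leq_mul => //; apply: wtS.
  by apply/subsetP=> x; rewrite !inE; case: (x \in A) => //; rewrite ?andbF ?andbT ?negbK.
have := covering sA' hB => hcov.
(* Otherwise [Y] would cover all that [A :\: B] covers, which is more than half of target 0, while
   it covers less than a quarter. *)
have [y yA' ynY] : exists2 y, y \in A :\: B & ~~ (nb [set y] \subset nb Y).
  apply/exists_inP; apply: contraTT hcov; rewrite negb_exists_in -leqNgt => /forall_inP h.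
  apply: (@leq_trans (4 * wt (rho 0) (nb Y :&: D 0))); last exact: ltnW (low _ m_gt0).
  apply: leq_mul => //; apply: wtS; apply: setSI; apply/subsetP=> z /nbP[y yA ryz].
  have := h _ yA; rewrite negbK => /subsetP; apply; by rewrite in_nb1.
have [yA yB] : y \in A /\ y \notin B by move: yA'; rewrite inE => /andP[].
pose Y' := y |: Y; pose g' x := if x \in nb Y then g x else y.
have nbY' : nb Y' = nb [set y] :|: nb Y by rewrite /Y' nbU.
pose F i := (nb [set y] :\: nb Y) :&: D i.
have Ei i : nb Y' :&: D i :&: nb Y = nb Y :&: D i.
  by apply/setP=> x; rewrite nbY' !inE; case: [exists _ in Y, _]; rewrite ?orbT ?andbT ?andbF.
have Fi i : nb Y' :&: D i :\: nb Y = F i.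
  apply/setP=> x; rewrite nbY' !in_setD !in_setI !in_setU in_setD.
  by case: (x \in nb Y); rewrite ?orbF.
have wF i : i < m -> k * wt (rho i) (F i) <= t i.
  move=> im; apply: leq_trans (small_step im yA); apply: leq_mul => //; apply: wtS.
  by apply: setSI; apply: subsetDl.
have wY' i : wt (rho i) (nb Y' :&: D i) = wt (rho i) (nb Y :&: D i) + wt (rho i) (F i).
  by rewrite (wtID _ _ (nb Y)) Ei Fi.
exists Y', g'; split.
- split.
  + by rewrite subUset sub1set yA.
  + move=> x; rewrite nbY' inE /g'; case: ifP => [xY _|_ /orP[]//].
      by have [gx rx] := gY _ xY; rewrite inE gx orbT.
    by rewrite in_nb1 rs => ->; rewrite setU11.
  + move=> i im; rewrite wY'.
    set E := nb Y :&: D i.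
    have gE x : x \in E -> g' x = g x by rewrite /g' inE => /andP[->].
    have gF x : x \in F i -> g' x = y.
      by rewrite /g' !inE => /andP[/andP[/negPf-> _] _].
    have b_le : k * wt (rho i) (E :&: [set x | r (g x) y]) <= t i.
      rewrite leqNgt; apply: contra yB => h; apply/bigcupP.
      by exists (Ordinal im) => //; rewrite inE yA.
    set b := wt _ _ in b_le.
    have -> : pairs i Y' g' = pairs i Y g + b * wt (rho i) (F i) +
                 (wt (rho i) (F i) * b + wt (rho i) (F i) * wt (rho i) (F i)).
      rewrite /pairs [LHS](big_setID (nb Y)) /= Ei Fi -/E; congr (_ + _).
        rewrite /b wt_indic big_distrl -big_split /=; apply: eq_bigr => x xE.
        rewrite [LHS](big_setID (nb Y)) /= Ei Fi -/E; congr (_ + _).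
          by apply: eq_bigr => x' xE'; rewrite (gE x xE) (gE x' xE').
        rewrite /wt big_distrr /=; apply: eq_bigr => x' xF.
        by rewrite (gE x xE) (gF x' xF); lia.
      rewrite -mulnDr {2}/wt big_distrl /=; apply: eq_bigr => x xF.
      rewrite [LHS](big_setID (nb Y)) /= Ei Fi -/E mulnDr; congr (_ + _).
        rewrite /b wt_indic big_distrr /=; apply: eq_bigr => x' xE'.
        by rewrite (gE x' xE') (gF x xF) rs; lia.
      rewrite /wt big_distrr /=; apply: eq_bigr => x' xF'.
      by rewrite (gF x xF) (gF x' xF') rr muln1.
    have := pY _ im; have := wF _ im; rewrite -/E; nia.
- rewrite nbY' setCU; apply: proper_card; apply/properP; split; first exact: subsetIr.
  have /subsetPn[z zy zY] := ynY.
  by exists z; [rewrite in_setC zY | rewrite in_setI !in_setC zy].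
- move=> i im; rewrite wY'; have := low _ im; have := wF _ im; nia.
Qed.

Lemma grow_inv Y g : inv Y g -> (forall i, i < m -> 2 * wt (rho i) (nb Y :&: D i) <= t i) ->
  exists Y' g', [/\ inv Y' g', forall i, i < m -> 2 * wt (rho i) (nb Y' :&: D i) <= t i
    & exists2 i, i < m & t i <= 4 * wt (rho i) (nb Y' :&: D i)].
Proof.
have [n le_n] := ubnP #|~: nb Y|; elim: n Y g le_n => // n IH Y g le_n iY h2.
case: (boolP [exists i : 'I_m, t i <= 4 * wt (rho i) (nb Y :&: D i)]) => [/existsP[i hi]|].
  by exists Y, g; split=> //; exists i.
rewrite negb_exists => /forallP low.
have low' i : i < m -> 4 * wt (rho i) (nb Y :&: D i) < t i.
  by move=> im; have := low (Ordinal im); rewrite -ltnNge.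
have [Y' [g' [iY' lt_Y h2']]] := grow_step iY low'.
by apply: (IH Y' g') => //; apply: leq_trans lt_Y _; rewrite -ltnS.
Qed.

(** Markov's inequality turns the average bound on [pairs] into a pointwise one: overloaded vertices
    of [Y] are dropped together with what is assigned to them. As [24 = 3 * 8], this loses at most
    [t i / 8] of a covered weight of at least [t i / 4]. *)
Lemma finite_grow k' : 24 * (k' * k') <= k -> 0 < k' ->
  exists (Y E : {set T}) g i, [/\ Y \subset A, i < m /\ E \subset D i,
    forall x, x \in E -> g x \in Y /\ r x (g x), t i <= 8 * wt (rho i) E
    & (forall y, y \in Y -> k' * wt (rho i) [set x in E | r (g x) y] <= t i) /\
      (forall j, j < m -> 2 * wt (rho j) (nb Y :&: D j) <= t j)].
Proof.
move=> kk' k'0.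
have nb0 : nb set0 = set0.
  by apply/setP=> x; rewrite !inE; apply/existsP; case=> y; rewrite inE.
have inv0 : inv set0 id.
  split=> [|x|i im]; [exact: sub0set|by rewrite nb0 inE|].
  by rewrite /pairs nb0 set0I big_set0 muln0.
have low0 i : i < m -> 2 * wt (rho i) (nb set0 :&: D i) <= t i.
  by rewrite nb0 set0I /wt big_set0.
have [Y [g [iY h2 [i im hi]]]] := grow_inv inv0 low0; case: (iY) => sYA gY pY.
have ti := tpos im.
pose E0 := nb Y :&: D i.
pose B := [set y in Y | t i < k' * wt (rho i) [set x in E0 | r (g x) y]].
pose E := [set x in E0 | g x \notin B].
exists (Y :\: B), E, g, i; split.
- exact: subset_trans (subsetDl _ _) sYA.
- by split=> //; apply/subsetP=> x; rewrite in_set => /andP[/setIP[]].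
- move=> x; rewrite in_set => /andP[/setIP[xY _] gxB]; have [gx rx] := gY _ xY.
  by rewrite in_setD gxB gx.
- have EB : E0 :&: E = E by apply/setIidPr/subsetP=> x; rewrite in_set => /andP[].
  have hB : t i * wt (rho i) (E0 :\: E) <= k' * pairs i Y g.
    rewrite /wt /pairs !big_distrr /= -/E0 [leqRHS](big_setID E) /=.
    apply: leq_trans (leq_addl _ _); apply: leq_sum => x; rewrite in_setD => /andP[xE xE0].
    have : g x \in B by move: xE; rewrite inE xE0 /= negbK.
    rewrite inE => /andP[_ hx].
    have -> : \sum_(x' in E0) rho i x * rho i x' * r (g x) (g x') =
       rho i x * wt (rho i) [set x0 in E0 | r (g x0) (g x)].
      have -> : [set x0 in E0 | r (g x0) (g x)] = E0 :&: [set x0 | r (g x0) (g x)].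
        by apply/setP=> z; rewrite !inE.
      rewrite wt_indic big_distrr /=; apply: eq_bigr => x' _; rewrite rs; lia.
    nia.
  have := pY _ im; have hE := wtID (rho i) E0 E; rewrite EB in hE.
  move: hB hE hi; rewrite -/E0; set a := wt _ (E0 :\: E); set b := wt _ E; set c := wt _ E0.
  set p := pairs _ _ _ => hB hE hi hp.
  have c_le : c <= t i by apply: wtS; apply: subsetIr.
  have h1 : 24 * (k' * k') * (t i * a) <= k' * (3 * (t i * t i)).
    apply: (@leq_trans (k' * (k * p))); first by nia.
    by apply: leq_mul => //; apply: leq_trans hp _; nia.
  have : (3 * k' * t i) * (8 * k' * a) <= (3 * k' * t i) * t i by nia.
  rewrite leq_mul2l => /orP[/eqP h0|]; first by nia.
  nia.
- split=> [y|j jm].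
    rewrite in_setD => /andP[yB yY].
    apply: (@leq_trans (k' * wt (rho i) [set x in E0 | r (g x) y])).
      apply: leq_mul => //; apply: wtS; apply/subsetP=> x; rewrite !inE.
      by move=> /andP[/andP[-> _] ->].
    by rewrite leqNgt; apply: contra yB => h; rewrite inE yY.
  apply: leq_trans (h2 _ jm); rewrite leq_mul2l /=; apply: wtS; apply: setSI; apply: nbS.
  exact: subsetDl.
Qed.

End Grow.
End FiniteWeights.

(** * Binomial trees *)

(* The vertices of the binomial tree of rank [k] are the strictly decreasing words over
   [0, ..., k - 1]; [par u v] says that [u] is the parent of [v]. *)
Definition par (u v : seq nat) := (u == take (size u) v) && (size v == (size u).+1).

Lemma par_cons a u b v : par (a :: u) (b :: v) = (a == b) && par u v.
Proof. by rewrite /par /= eqseq_cons eqSS andbA. Qed.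

Lemma par_nil a v : par [::] (a :: v) = (v == [::]).
Proof. by rewrite /par /= eqSS size_eq0. Qed.

Lemma par_rcons u v a : par u (rcons v a) = (u == v).
Proof.
rewrite /par size_rcons eqSS; apply/andP/eqP => [[/eqP h /eqP s]|->].
  by rewrite h -s -cats1 take_size_cat.
by rewrite -cats1 take_size_cat ?eqxx.
Qed.

Section Trees.
Variables (T : finType) (e : rel T).
Hypotheses (es : symmetric e) (ei : irreflexive e).
Implicit Types (S X : {set T}).

Definition clo : rel T := fun x y => (x == y) || e x y.

Lemma clo_refl : reflexive clo. Proof. by move=> x; rewrite /clo eqxx. Qed.
Lemma clo_sym : symmetric clo. Proof. by move=> x y; rewrite /clo eq_sym es. Qed.

(* [tree k x S]: the set [S] induces a binomial tree of rank [k] rooted at [x]. *)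
Fixpoint tree k x S : Prop :=
  if k is k'.+1 then exists S1 S2 y, [/\ tree k' x S1, tree k' y S2, S = S1 :|: S2, e x y &
    forall a b, a \in S1 -> b \in S2 -> clo a b -> a = x /\ b = y]
  else S = [set x].

Lemma tree_le k j x S : j <= k -> tree k x S -> exists2 S' : {set T}, S' \subset S & tree j x S'.
Proof.
elim: k S => [|k IH] S; first by rewrite leqn0 => /eqP->; exists S.
rewrite leq_eqVlt => /orP[/eqP->|]; first by exists S.
rewrite ltnS => jk /= [S1 [S2 [y [/(IH _ jk)[S' sS t'] _ -> _ _]]]].
by exists S' => //; apply: subset_trans sS (subsetUl _ _).
Qed.

Lemma tree_words k x S : tree k x S -> exists f : seq nat -> T,
  [/\ f [::] = x, forall u, path gtn k u -> f u \in S,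
   forall u v, path gtn k u -> path gtn k v -> f u = f v -> u = v
   & forall u v, path gtn k u -> path gtn k v -> e (f u) (f v) = par u v || par v u].
Proof.
elim: k x S => [|k IH] x S /=.
  have w0 u : path gtn 0 u -> u = [::] by case: u.
  move=> ->; exists (fun=> x); split=> [//|u _|u v|u v]; first by rewrite set11.
    by move=> /w0-> /w0->.
  by move=> /w0-> /w0->; rewrite ei.
case=> S1 [S2 [y [t1 t2 -> exy sep]]].
have [f1 [f1x f1S inj1 e1]] := IH _ _ t1.
have [f2 [f2y f2S inj2 e2]] := IH _ _ t2.
(* Words starting with the letter [k] name the second copy, and [[:: k]] its root [y]; all other
   words name the first copy. *)
pose f u := if u is a :: u' then if a == k then f2 u' else f1 u else f1 u.
have wordP u : path gtn k.+1 u -> (exists2 u', u = k :: u' & path gtn k u') \/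
     (path gtn k u /\ f u = f1 u).
  case: u => [|a u] /=; first by right.
  rewrite ltnS leq_eqVlt => /andP[/orP[/eqP->|ak] pu]; first by left; exists u.
  by right; rewrite ak pu (ltn_eqF ak).
have fk u : f (k :: u) = f2 u by rewrite /f eqxx.
have nhead u : path gtn k u -> forall u', u <> k :: u'.
  by case: u => [|a u] //= /andP[ak _] u' [ek _]; rewrite ek ltnn in ak.
have cross u v : path gtn k u -> path gtn k v -> clo (f1 u) (f2 v) -> u = [::] /\ v = [::].
  move=> pu pv /(sep _ _ (f1S _ pu) (f2S _ pv))[hx hy]; split.
    by apply: inj1; rewrite ?f1x.
  by apply: inj2; rewrite ?f2y.
have parc u v : path gtn k u -> par u (k :: v) || par (k :: v) u = (u == [::]) && (v == [::]).
  case: u => [|a u] /=; first by rewrite par_nil /par /= orbF.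
  by case/andP=> ak _; rewrite !par_cons (ltn_eqF ak) eq_sym (ltn_eqF ak).
have ec u v : path gtn k u -> path gtn k v -> e (f1 u) (f2 v) = (u == [::]) && (v == [::]).
  move=> pu pv; apply/idP/andP => [h|[/eqP-> /eqP->]]; last by rewrite f1x f2y.
  by have [-> ->] := cross _ _ pu pv (introT orP (or_intror h)).
exists f; split.
- by rewrite /f f1x.
- move=> u /wordP[[u' -> pu']|[pu ->]]; rewrite ?fk inE ?(f2S _ pu') ?orbT //.
  by rewrite (f1S _ pu).
- move=> u v /wordP[[u' -> pu']|[pu ->]] /wordP[[v' -> pv']|[pv ->]]; rewrite ?fk.
  + by move/(inj2 _ _ pu' pv')->.
  + move=> h; have [ev eu] : v = [::] /\ u' = [::] by apply: cross => //; rewrite h clo_refl.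
    by move: h exy; rewrite ev eu f1x f2y => ->; rewrite ei.
  + move=> h; have [ev eu] : u = [::] /\ v' = [::] by apply: cross => //; rewrite h clo_refl.
    by move: h exy; rewrite ev eu f1x f2y => ->; rewrite ei.
  + exact: inj1.
- move=> u v /wordP[[u' -> pu']|[pu ->]] /wordP[[v' -> pv']|[pv ->]]; rewrite ?fk.
  + by rewrite e2 // !par_cons eqxx.
  + by rewrite es ec // orbC parc.
  + by rewrite ec // parc.
  + exact: e1.
Qed.
End Trees.

(** * Forests inside binomial trees *)

Section Forests.
Variables (TH : finType) (eH : rel TH).
Hypotheses (hs : symmetric eH) (hi : irreflexive eH) (hf : forest eH).

(** The end of a maximal path is such a vertex: a further neighbour would prolong the path or close
    a cycle. The induction measures how far the path is from the impossible length [#|W| + 1]. *)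
Lemma forest_leaf (W : {set TH}) : W != set0 ->
  exists2 v, v \in W & #|[set y in W | eH v y]| <= 1.
Proof.
case/set0Pn=> v0 v0W.
pose good (p : seq TH) := [&& uniq p, all [in W] p & sorted eH p].
have [n] : exists n, exists2 p, good p & size p + n = #|W|.+1.
  exists #|W|, [:: v0]; rewrite /good /= ?v0W //.
elim: n => [|n IH] [p gp sp].
  case/and3P: gp => up /allP aW _; have : size p <= #|W|.
    by rewrite -(card_uniqP up); apply: subset_leq_card; apply/subsetP.
  by rewrite -ltnS -sp addn0 ltnn.
case: p gp sp => [|x p] gp sp.
  by apply: IH; exists [:: v0]; rewrite /good /= ?v0W //; move: sp => /= ->; lia.
case/and3P: (gp) => up aW pp.
have xW : x \in W by move: aW => /= /andP[].
case: (leqP #|[set y in W | eH x y]| 1) => [h|h]; first by exists x.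
have [y yW] : exists2 y, y \in [set y in W | eH x y] & y != head x p.
  have /card_gt0P[y] : 0 < #|[set y in W | eH x y] :\ head x p|.
    by have := cardsD1 (head x p) [set y in W | eH x y]; case: (_ \in _) => /=; lia.
  by rewrite !inE => /andP[? ?]; exists y; rewrite ?inE.
move: yW; rewrite inE => /andP[yW exy] yh.
have yx : y != x by apply: contraL exy => /eqP->; rewrite hi.
case: (boolP (y \in p)) => yp; last first.
  apply: IH; exists (y :: x :: p); last by move: sp => /=; lia.
  move: up aW pp; rewrite /good /= => -> /andP[-> ->] ->.
  by rewrite inE negb_or yx yp yW hs exy.
have [p1 [p2 def_p]] : exists p1 p2, p = rcons p1 y ++ p2.
  by case/path.splitP: yp => p1 p2; exists p1, p2.
have uc : uniq (x :: rcons p1 y) by move: up; rewrite def_p -cat_cons cat_uniq => /and3P[].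
have sc : 3 <= size (x :: rcons p1 y).
  case: p1 def_p {uc} => [|a p1] def_p; last by rewrite /= size_rcons.
  by rewrite def_p /= eqxx in yh.
have /negP[] := hf uc sc.
rewrite /= rcons_path last_rcons hs exy andbT.
by move: pp; rewrite def_p /= cat_path => /andP[].
Qed.

(** A leaf is removed and later named by appending to the word of its neighbour a letter smaller
    than all letters in use, so its word is the parent of no other. The empty word is kept free: a
    leaf without neighbour gets a one-letter word, whose parent is the empty word and hence names
    nothing. *)
Lemma forest_words (W : {set TH}) : exists g : TH -> seq nat,
  [/\ forall x, x \in W -> path gtn #|TH| (g x) /\ g x != [::],
   forall x, x \in W -> all (leq (#|TH| - #|W|)) (g x),
   {in W &, injective g}
   & {in W &, forall x y, eH x y = par (g x) (g y) || par (g y) (g x)}].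
Proof.
have [n] := ubnP #|W|; elim: n W => // n IH W; rewrite ltnS => le_n.
case: (eqVneq W set0) => [->|W0].
  by exists (fun=> [::]); split=> [x|x|x y|x y]; rewrite !inE.
have [v vW lv] := forest_leaf W0.
have cW := cardsD1 v W; rewrite vW /= in cW.
have cT : #|W| <= #|TH| by apply: max_card.
have [|g [gp gl ginj ge]] := IH (W :\ v); first by lia.
have aS : #|TH| - #|W :\ v| = (#|TH| - #|W|).+1.
  by move: cT; rewrite cW; move: #|W :\ v| #|TH| => c d; lia.
rewrite aS in gl; set a := #|TH| - #|W|.
have alt : a < #|TH| by rewrite /a; move: cT aS; move: #|W :\ v| #|W| #|TH| => b c d; lia.
have [gv gvE] : exists gv, (exists2 p, p \in W :\ v /\ eH v p & gv = rcons (g p) a) \/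
    (forall y, y \in W :\ v -> ~~ eH v y) /\ gv = [:: a].
  case: (pickP [pred p in W :\ v | eH v p]) => [p /andP[pW evp]|no].
    by exists (rcons (g p) a); left; exists p.
  by exists [:: a]; right; split=> // y yW; have := no y; rewrite /= yW /= => ->.
have small x : x \in W :\ v -> all (ltn a) (g x).
  exact: gl.
have anotin x : x \in W :\ v -> a \notin g x.
  by move=> xW; apply/negP => /(allP (small _ xW)); rewrite /= ltnn.
have agv : a \in gv by case: gvE => [[p _ ->]|[_ ->]]; rewrite ?mem_rcons ?mem_head.
have gvP y : y \in W :\ v -> eH v y = par (g y) gv.
  move=> yW; case: gvE => [[p [pW evp] ->]|[no ->]]; last first.
    by rewrite (negPf (no _ yW)) (par_rcons _ [::]); have [_ /negPf->] := gp _ yW.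
  rewrite par_rcons; apply/idP/eqP => [evy|/(ginj _ _ yW pW)->//].
  congr g; apply/eqP; apply: contraTT lv => yp; rewrite -ltnNge.
  have /subset_leq_card : [set y; p] \subset [set y0 in W | eH v y0].
    apply/subsetP=> z; rewrite !inE => /orP[/eqP->|/eqP->].
      by move: yW; rewrite evy !inE => /andP[_ ->].
    by move: pW; rewrite evp !inE => /andP[_ ->].
  by rewrite cards2 yp.
have parv x : x \in W :\ v -> par gv (g x) = false.
  move=> xW; apply/negP => /andP[/eqP h _]; move/negP: (anotin _ xW); apply.
  by move: agv; rewrite h => /mem_take.
have inW x : x \in W -> x != v -> x \in W :\ v by move=> xW xv; rewrite !inE xv.
exists (fun x => if x == v then gv else g x); split.
- move=> x xW; case: ifPn => [_|/(inW _ xW)]; last exact: gp.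
  case: gvE => [[p [pW evp] ->]|[_ ->]] /=; last by rewrite andbT alt.
  have [pp _] := gp _ pW; rewrite rcons_path pp /=; split; last by case: (g p).
  have := small _ pW; case: (g p) => [|b s] h; first by rewrite /= alt.
  exact: (allP h _ (mem_last b s)).
- move=> x xW; case: ifPn => [_|/(inW _ xW) xW']; last first.
    by apply: sub_all (small _ xW') => b /=; apply: ltnW.
  case: gvE => [[p [pW evp] ->]|[_ ->]] /=; last by rewrite leqnn.
  by rewrite all_rcons leqnn /=; apply: sub_all (small _ pW) => b /=; apply: ltnW.
- move=> x y xW yW; case: ifPn => [/eqP->|/(inW _ xW) xW'];
    case: ifPn => [/eqP->|/(inW _ yW) yW'] //.
  + by move=> h; move: (anotin _ yW'); rewrite -h agv.
  + by move=> h; move: (anotin _ xW'); rewrite h agv.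
  + exact: ginj.
- move=> x y xW yW; case: ifPn => [/eqP->|/(inW _ xW) xW'];
    case: ifPn => [/eqP->|/(inW _ yW) yW'].
  + by rewrite hi orbb; apply/esym/negP => /andP[_ /eqP]; lia.
  + by rewrite parv // gvP.
  + by rewrite parv // orbF hs gvP.
  + exact: ge.
Qed.

Lemma tree_contains (T : finType) (e : rel T) x S : simple_graph e ->
  tree e #|TH| x S -> contains e eH.
Proof.
case=> es ei /(tree_words es ei)[f [_ _ finj fe]].
have [g [gp _ ginj ge]] := forest_words [set: TH].
exists (f \o g); split=> [u v /= h|u v /=].
  have [pu _] := gp u (in_setT _); have [pv _] := gp v (in_setT _).
  by apply: ginj; rewrite ?inE //; apply: finj.
have [pu _] := gp u (in_setT _); have [pv _] := gp v (in_setT _).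
by rewrite fe // -ge ?inE.
Qed.
End Forests.

(** * Ultrafilters and internal sets *)

Record ultra (large : (nat -> Prop) -> Prop) : Prop := Ultra {
  ultra_and : forall P Q, large P -> large Q -> large (fun n => P n /\ Q n);
  ultra_imp : forall P Q, (forall n, P n -> Q n) -> large P -> large Q;
  ultra_or : forall P, large P \/ large (fun n => ~ P n);
  ultra_false : ~ large (fun _ => False);
  ultra_large : forall k, large (fun n => k <= n) }.

Section Ultra.
Variables (large : (nat -> Prop) -> Prop) (Uu : ultra large).

Lemma ultra_all (P : nat -> Prop) : (forall n, P n) -> large P.
Proof. by move=> h; apply: (ultra_imp Uu) (ultra_large Uu 0) => n _. Qed.

Lemma ultra_and3 (P Q R S : nat -> Prop) : (forall n, P n -> Q n -> R n -> S n) ->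
  large P -> large Q -> large R -> large S.
Proof.
move=> h p q s; apply: (ultra_imp Uu) (ultra_and Uu p (ultra_and Uu q s)).
by move=> n [? [? ?]]; apply: h.
Qed.

Lemma ultra_and2 (P Q S : nat -> Prop) : (forall n, P n -> Q n -> S n) -> large P -> large Q -> large S.
Proof.
by move=> h p q; apply: (ultra_imp Uu) (ultra_and Uu p q) => n [? ?]; apply: h.
Qed.

Lemma ultra_ex (P : nat -> Prop) : large P -> exists n, P n.
Proof.
move=> h; apply: contrapT => no; apply: (ultra_false Uu).
by apply: (ultra_imp Uu) h => n p; apply: no; exists n.
Qed.

Lemma ultra_forall_lt m (P : nat -> nat -> Prop) :
  (forall i, i < m -> large (P i)) -> large (fun n => forall i, i < m -> P i n).
Proof.
elim: m => [|m IH] h; first by apply: ultra_all.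
have h1 := IH (fun i im => h i (ltnW im)).
apply: (ultra_and2 _ h1 (h m (ltnSn m))) => n a b i.
by rewrite ltnS leq_eqVlt => /orP[/eqP->|]; [|apply: a].
Qed.

Lemma ultra_pigeon m (i : nat -> nat) : large (fun n => i n < m) ->
  exists2 j, j < m & large (fun n => i n = j).
Proof.
elim: m => [|m IH] h; first by case: (ultra_false Uu); apply: (ultra_imp Uu) h.
case: (ultra_or Uu (fun n => i n = m)) => [|hm]; first by exists m.
case: IH => [|j jm hj]; last by exists j; rewrite // ltnS ltnW.
by apply: (ultra_and2 _ h hm) => n; rewrite ltnS leq_eqVlt => /orP[/eqP->|].
Qed.

Fixpoint last_true (P : nat -> Prop) n : nat :=
  if n is m.+1 then if `[< P n >] then n else last_true P m else 0.

Lemma last_true_leq P n k : k <= n -> P k -> k <= last_true P n.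
Proof.
elim: n => [|n IH] /=; first by rewrite leqn0 => /eqP->.
by rewrite leq_eqVlt; case: asboolP => [_|nP] /orP[/eqP-> //|kn pk]; [apply: ltnW|apply: IH].
Qed.

Lemma last_trueP P n : 0 < last_true P n -> P (last_true P n).
Proof. by elim: n => //= n IH; case: asboolP. Qed.

(** All standard properties are made to hold at one infinite index: [kappa n] is the largest
    [k <= n] with [P k n]. The bound [n] makes the maximum exist, and 0 stands for no positive
    [k]. *)
Lemma overspill (P : nat -> nat -> Prop) : (forall k, large (P k)) ->
  exists kappa : nat -> nat,
    (forall k, large (fun n => k <= kappa n)) /\ forall n, 0 < kappa n -> P (kappa n) n.
Proof.
move=> h; exists (fun n => last_true (P ^~ n) n); split=> [k|n]; last exact: last_trueP.
apply: (ultra_and2 _ (h k) (ultra_large Uu k)) => n pk kn.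
exact: last_true_leq.
Qed.
End Ultra.

(** * Internal sets, infinitesimal parts, and growth in the limit *)

Class graph_seq := GraphSeq {
  ver : nat -> finType;
  edg : forall n, rel (ver n);
  large : (nat -> Prop) -> Prop;
  edg_sym : forall n, symmetric (@edg n);
  Uu : ultra large }.
Arguments edg {graph_seq} n.
Arguments edg_sym {graph_seq} n.

Section Internal.
Context {G : graph_seq}.

(* Representatives of internal sets, weights and functions of the ultraproduct. *)
Definition iset := forall n, {set ver n}.
Definition iwt := forall n, ver n -> nat.
Definition ifun := forall n, ver n -> ver n.
Implicit Types (A B D E M Q X Y S : iset) (w u rho : iwt) (f g : ifun).

Local Notation r n := (clo (edg n)).
Definition sub A B := forall n, A n \subset B n.
Definition icup A B : iset := fun n => A n :|: B n.
Definition idif A B : iset := fun n => A n :\: B n.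
Definition iN A : iset := fun n => nb (r n) (A n).
Definition tot w n := wt (w n) setT.
(* Relative to the total weight, [pos] means non-infinitesimal, and [smallr Y w D] that single
   vertices of [Y] have an infinitesimal closed neighbourhood in [D]. *)
Definition pos w A := exists k, large (fun n => tot w n < k * wt (w n) (A n)).
Definition smallr Y w D := forall k, large (fun n => forall y, y \in Y n ->
  k * wt (w n) (nb (r n) [set y] :&: D n) <= tot w n).
Definition sparse X w D f := forall k, large (fun n => forall y, y \in X n ->
  k * wt (w n) [set x in D n | r n (f n x) y] <= tot w n).

Lemma wt_tot w A n : wt (w n) (A n) <= tot w n.
Proof. by apply: wtS; apply: subsetT. Qed.

Lemma sub_refl A : sub A A. Proof. by move=> n. Qed.
Lemma sub_trans B A C : sub A B -> sub B C -> sub A C.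
Proof. by move=> h1 h2 n; apply: subset_trans (h1 n) (h2 n). Qed.
Lemma sub_cupl A B : sub A (icup A B). Proof. by move=> n; apply: subsetUl. Qed.
Lemma sub_cupr A B : sub B (icup A B). Proof. by move=> n; apply: subsetUr. Qed.
Lemma sub_dif A B : sub (idif A B) A. Proof. by move=> n; apply: subsetDl. Qed.
Lemma sub_cup A B C : sub A C -> sub B C -> sub (icup A B) C.
Proof. by move=> h1 h2 n; rewrite subUset h1 h2. Qed.

Lemma nullP w A : ~ pos w A <-> forall k, large (fun n => k * wt (w n) (A n) <= tot w n).
Proof.
split=> [h k|h [k hk]].
  case: (ultra_or Uu (fun n => k * wt (w n) (A n) <= tot w n)) => // h'.
  case: h; exists k; apply: (ultra_imp Uu) h' => n /negP; by rewrite -ltnNge.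
apply: (ultra_false Uu); apply: (ultra_and2 Uu _ hk (h k)) => n h1 h2.
by move: (leq_ltn_trans h2 h1); rewrite ltnn.
Qed.

Lemma pos_sub w A B : sub A B -> pos w A -> pos w B.
Proof.
move=> sAB [k hk]; exists k; apply: (ultra_imp Uu) hk => n h.
by apply: leq_trans h _; rewrite leq_mul2l wtS ?orbT.
Qed.

Lemma pos_cover w A B C : sub A (icup B C) -> pos w A -> pos w B \/ pos w C.
Proof.
move=> sA pA; apply: contrapT => /not_orP[/nullP nB /nullP nC].
have : ~ pos w A; last exact.
apply/nullP=> k; apply: (ultra_and2 Uu _ (nB (2 * k)) (nC (2 * k))) => n hB hC.
have := wtS (w n) (sA n); have := wtU (w n) (B n) (C n); rewrite /icup; nia.
Qed.

Lemma pos_inh w A : pos w A -> exists n x, x \in A n.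
Proof.
case=> k /(ultra_ex Uu)[n h]; exists n; apply/set0Pn; apply: contraTneq h => ->.
by rewrite /wt big_set0 muln0.
Qed.

Lemma smallr_sub Y Y' w D D' : sub Y' Y -> sub D' D -> smallr Y w D -> smallr Y' w D'.
Proof.
move=> sY sD h k; apply: (ultra_imp Uu) (h k) => n hn y yY.
apply: leq_trans (hn y (subsetP (sY n) _ yY)); rewrite leq_mul2l wtS ?orbT //.
exact: setIS.
Qed.

Lemma sparse_sub X X' w D D' f : sub X' X -> sub D' D -> sparse X w D f -> sparse X' w D' f.
Proof.
move=> sX sD h k; apply: (ultra_imp Uu) (h k) => n hn y yX.
apply: leq_trans (hn y (subsetP (sX n) _ yX)); rewrite leq_mul2l wtS ?orbT //.
by apply/subsetP=> x; rewrite !inE => /andP[/(subsetP (sD n))-> ->].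
Qed.

(* The last hypothesis only guarantees that the process cannot stop before some target is hit; the
   target [i] that is hit need not be target [0]. *)
Lemma grow m A w (D : nat -> iset) (rho : nat -> iwt) : 0 < m -> pos w A -> smallr A w A ->
  (forall i, i < m -> pos (rho i) (D i)) -> (forall i, i < m -> smallr A (rho i) (D i)) ->
  (forall A', sub A' A -> ~ pos w (idif A A') -> ~ pos (rho 0) (idif (D 0) (iN A'))) ->
  exists Y i E g, [/\ sub Y A, [/\ i < m, sub E (D i) & pos (rho i) E],
    forall n x, x \in E n -> g n x \in Y n /\ r n x (g n x),
    sparse Y (rho i) E g & forall j, j < m -> pos (rho j) (idif (D j) (iN Y))].
Proof.
move=> m0 [kA pA] sA pD sD cov.
pose t n i := wt (rho i n) (D i n).
have {}pA : exists k, large (fun n => tot w n < k * wt (w n) (A n)) by exists kA.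
pose H3 k n := forall A' : {set ver n}, A' \subset A n -> k * wt (w n) (A n :\: A') <= wt (w n) (A n) ->
  t n 0 < 2 * wt (rho 0 n) (nb (r n) A' :&: D 0 n).
(* Without a uniform [k0], overspill would give an internal [A'] that misses only an infinitesimal
   part of [A] and yet covers at most half of target 0. *)
have [k0 h3] : exists k0, large (H3 k0).
  apply: contrapT => /forallNP no.
  have no' k : large (fun n => ~ H3 k n) by case: (ultra_or Uu (H3 k)) => // /no.
  have [kap [kapU kapP]] := overspill Uu no'.
  have ch n : exists A' : {set ver n}, A' \subset A n /\ (0 < kap n ->
      kap n * wt (w n) (A n :\: A') <= wt (w n) (A n) /\
      2 * wt (rho 0 n) (nb (r n) A' :&: D 0 n) <= t n 0).
    case: (posnP (kap n)) => [->|k0]; first by exists (A n).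
    have /existsNP[A' /not_implyP[s1 /not_implyP[s2 /negP s3]]] := kapP _ k0.
    exists A'; split=> // _; split=> //; by rewrite leqNgt.
  pose A' : iset := fun n => projT1 (cid (ch n)).
  have sA' : sub A' A by move=> n; case: (projT2 (cid (ch n))).
  have hA' n : 0 < kap n -> kap n * wt (w n) (A n :\: A' n) <= wt (w n) (A n) /\
      2 * wt (rho 0 n) (nb (r n) (A' n) :&: D 0 n) <= t n 0.
    by case: (projT2 (cid (ch n))) => _; apply.
  apply: (cov A' sA').
    apply/nullP => k; apply: (ultra_imp Uu) (kapU k.+1) => n kk.
    have [h _] := hA' n (leq_ltn_trans (leq0n _) kk).
    apply: leq_trans (wt_tot w A n); apply: leq_trans h.
    by rewrite leq_mul2r (ltnW kk) orbT.
  have [k hk] := pD 0 m0; exists (2 * k); apply: (ultra_and2 Uu _ hk (kapU 1)) => n h1 h2.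
  have [_ h] := hA' n h2; move: h1.
  rewrite (wtID _ (D 0 n) (iN A' n)) setIC; move: h; rewrite /t.
  by rewrite {1}(wtID _ (D 0 n) (iN A' n)) setIC /idif /iN; nia.
pose H k n := [/\ forall i, i < m -> 0 < t n i,
  forall i y, i < m -> y \in A n -> k * wt (rho i n) (nb (r n) [set y] :&: D i n) <= t n i
  & forall y, y \in A n -> m * (k * k) * wt (w n) (nb (r n) [set y] :&: A n) <= wt (w n) (A n)].
have UH k : large (H k).
  have h1 : large (fun n => forall i, i < m -> 0 < t n i /\ forall y, y \in A n ->
       k * wt (rho i n) (nb (r n) [set y] :&: D i n) <= t n i).
    apply: (ultra_forall_lt Uu) => i im; have [j hj] := pD i im.
    apply: (ultra_and2 Uu _ hj (sD i im (k * j))) => n; rewrite -/(t n i) => a b.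
    split=> [|y /b h]; first by move: a; case: (t n i) => //; rewrite muln0.
    have := leq_ltn_trans h a; rewrite [k * j]mulnC -mulnA ltn_mul2l => /andP[_ /ltnW].
    by [].
  have [j hj] := pA.
  apply: (ultra_and3 Uu _ h1 hj (sA (m * (k * k) * j))) => n a b c; split.
  - by move=> i /a[].
  - by move=> i y /a[_]; apply.
  - move=> y /c h; have := leq_ltn_trans h b.
    by rewrite [_ * j]mulnC -mulnA ltn_mul2l => /andP[_ /ltnW].
(* The three summands serve the three lower bounds on [k] in [finite_grow]. *)
have [kap [kapU kapP]] := overspill Uu (fun k => UH (24 * (k * k) + k0 + 8)).
pose res n (p : {set ver n} * {set ver n} * (ver n -> ver n) * nat) :=
  let: (Y, E, g, i) := p in [/\ Y \subset A n, i < m /\ E \subset D i n,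
    forall x, x \in E -> g x \in Y /\ r n x (g x), t n i <= 8 * wt (rho i n) E
    & (forall y, y \in Y -> kap n * wt (rho i n) [set x in E | r n (g x) y] <= t n i) /\
      (forall j, j < m -> 2 * wt (rho j n) (nb (r n) Y :&: D j n) <= t n j)].
have ch n : exists p, 0 < kap n -> H3 k0 n -> res n p.
  case: (posnP (kap n)) => [_|kn]; first by exists (set0, set0, id, 0).
  case: (pselect (H3 k0 n)) => [h3n|]; last by exists (set0, set0, id, 0).
  have [a b c] := kapP _ kn.
  have [|||Y [E [g [i h]]]] := @finite_grow (ver n) (r n) (@clo_refl _ (edg n)) (clo_sym (edg_sym n))
    (A n) (w n) m (fun i => D i n) (fun i => rho i n) _ k0 _ _ m0 a b c h3n (kap n) _ kn.
  - by rewrite leq_addl.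
  - by rewrite addnAC leq_addl.
  - by rewrite -addnA leq_addr.
  by exists (Y, E, g, i).
pose p n := projT1 (cid (ch n)).
have hp n : 0 < kap n -> H3 k0 n -> res n (p n) := projT2 (cid (ch n)).
have Ures : large (fun n => res n (p n)).
  by apply: (ultra_and2 Uu _ (kapU 1) h3) => n; apply: hp.
have [|i im Ui] := @ultra_pigeon large Uu m (fun n => (p n).2).
  apply: (ultra_imp Uu) Ures => n; rewrite /res.
  by case: (p n) => [[[Y E] g] i] [_ []].
pose ok n := `[< res n (p n) /\ (p n).2 = i >].
have Uok : large (fun n => ok n).
  by apply: (ultra_and2 Uu _ Ures Ui) => n a b; apply/asboolP.
(* Off the good indices the sets are empty, so inclusions and the assignment hold at every index. *)
pose Y : iset := fun n => if ok n then (p n).1.1.1 else set0.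
pose E : iset := fun n => if ok n then (p n).1.1.2 else set0.
pose g : ifun := fun n => (p n).1.2.
have okP n : ok n -> [/\ Y n \subset A n, E n \subset D i n,
    forall x, x \in E n -> g n x \in Y n /\ r n x (g n x), t n i <= 8 * wt (rho i n) (E n)
    & (forall y, y \in Y n -> kap n * wt (rho i n) [set x in E n | r n (g n x) y] <= t n i) /\
      (forall j, j < m -> 2 * wt (rho j n) (nb (r n) (Y n) :&: D j n) <= t n j)].
  rewrite /Y /E /g => ok_n; rewrite ok_n; move/asboolP: ok_n => []; rewrite /res.
  by case: (p n) => [[[Y' E'] g'] i'] /= [? [? ?] ? ? ?] <-.
exists Y, i, E, g; split.
- move=> n; case: (boolP (ok n)) => [/okP[]//|/negPf nok].
  by rewrite /Y nok sub0set.
- split=> // [n|]; first by case: (boolP (ok n)) => [/okP[]//|/negPf nok]; rewrite /E nok sub0set.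
  have [k hk] := pD i im; exists (k * 8).
  apply: (ultra_and2 Uu _ hk Uok) => n a /okP[_ _ _ h _].
  by apply: leq_trans a _; rewrite -mulnA leq_mul2l h orbT.
- move=> n x; case: (boolP (ok n)) => [/okP[_ _ h _ _]|/negPf nok]; first exact: h.
  by rewrite /E nok inE.
- move=> k; apply: (ultra_and2 Uu _ (kapU k) Uok) => n kk /okP[_ _ _ _ [h _]] y /h hy.
  apply: leq_trans (wt_tot _ (D i) n); apply: leq_trans hy.
  by rewrite leq_mul2r kk orbT.
- move=> j jm; have [k hk] := pD j jm; exists (2 * k).
  apply: (ultra_and2 Uu _ hk Uok) => n a /okP[_ _ _ _ [_ h]].
  have := h _ jm; move: a; rewrite /t {1 2}(wtID _ (D j n) (iN Y n)) setIC /idif /iN.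
  nia.
Qed.

End Internal.

Section Hits.
Context {G : graph_seq}.
Implicit Types (A B D E M Q X Y S : iset) (w u rho : iwt) (f g : ifun).
Local Notation r n := (clo (edg n)).

(** * Hits *)

Definition anti A B := forall n x y, x \in A n -> y \in B n -> ~~ r n x y.
Definition dis A B := forall n x, x \in A n -> x \in B n -> False.
(** A tree leaves [S] at most in its root, so adjacency between different vertices of [X] does no
    harm. *)
Definition ready k X S := forall n x, x \in X n ->
  exists2 S0 : {set ver n}, S0 \subset x |: S n & tree (edg n) k x S0.
Definition into f D X := forall n x, x \in D n -> f n x \in X n /\ r n x (f n x).

Lemma subP A B n x : sub A B -> x \in A n -> x \in B n.
Proof. by move=> s; apply: (subsetP (s n)). Qed.

Lemma anti_sym A B : anti A B -> anti B A.
Proof. by move=> h n x y xB yA; rewrite (clo_sym (edg_sym n)); apply: h. Qed.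
Lemma anti_sub A' B' A B : sub A A' -> sub B B' -> anti A' B' -> anti A B.
Proof. by move=> sA sB h n x y xA yB; apply: h; [apply: (subP sA)|apply: (subP sB)]. Qed.
Lemma anti_subl A' A B : sub A A' -> anti A' B -> anti A B.
Proof. by move=> sA; apply: anti_sub => //; apply: sub_refl. Qed.
Lemma anti_subr B' A B : sub B B' -> anti A B' -> anti A B.
Proof. by move=> sB; apply: anti_sub => //; apply: sub_refl. Qed.
Lemma anti_cupr A B D : anti A B -> anti A D -> anti A (icup B D).
Proof. by move=> h1 h2 n x y xA; rewrite inE => /orP[]; [apply: h1|apply: h2]. Qed.
Lemma anti_cupl A B D : anti B A -> anti D A -> anti (icup B D) A.
Proof. by move=> h1 h2; apply/anti_sym/anti_cupr; apply: anti_sym. Qed.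
Lemma anti_dif A B : anti (idif A (iN B)) B.
Proof.
move=> n x y; rewrite inE => /andP[xN _] yB; apply: contra xN => rxy.
by apply/nbP; exists y => //; rewrite (clo_sym (edg_sym n)).
Qed.
Lemma dis_sym A B : dis A B -> dis B A. Proof. by move=> h n x xB xA; apply: (h n x). Qed.
Lemma dis_sub A' B' A B : sub A A' -> sub B B' -> dis A' B' -> dis A B.
Proof. by move=> sA sB h n x xA xB; apply: (h n x); [apply: (subP sA)|apply: (subP sB)]. Qed.
Lemma dis_subl A' A B : sub A A' -> dis A' B -> dis A B.
Proof. by move=> sA; apply: dis_sub => //; apply: sub_refl. Qed.
Lemma dis_subr B' A B : sub B B' -> dis A B' -> dis A B.
Proof. by move=> sB; apply: dis_sub => //; apply: sub_refl. Qed.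

Lemma ready_sub k X X' S S' : sub X' X -> sub S S' -> ready k X S -> ready k X' S'.
Proof.
move=> sX sS h n x /(subP sX)/h[S0 s0 t0]; exists S0 => //.
by apply: subset_trans s0 (setUS _ (sS n)).
Qed.

Lemma ready_le k j X S : j <= k -> ready k X S -> ready j X S.
Proof.
move=> jk h n x /h[S0 s0 /(tree_le jk)[S1 s1 t1]].
by exists S1 => //; apply: subset_trans s1 s0.
Qed.

Lemma ready0 X S : ready 0 X S.
Proof. by move=> n x _; exists [set x] => //; apply: subsetUl. Qed.

Lemma into_sub f D D' X X' : sub D' D -> sub X X' -> into f D X -> into f D' X'.
Proof. by move=> sD sX h n x /(subP sD)/h[/(subP sX)]. Qed.

(** [M] can touch the trees only at their roots in [X]. The last two fields make [X], with the image
    measure, a source for [grow] against [M]. *)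
Record sparseHit k w M X S f : Prop := SparseHit {
  st_ready : ready k X S;
  st_anti : anti M S;
  st_dis : dis M X;
  st_into : into f M X;
  st_small : smallr X w M;
  st_sparse : sparse X w M f }.

Lemma sparseHit_sub k w M M' X S f : sub M' M -> sparseHit k w M X S f -> sparseHit k w M' X S f.
Proof.
move=> sM [h1 h2 h3 h4 h5 h6]; split=> //.
- exact: anti_subl h2.
- exact: dis_subl h3.
- by apply: into_sub h4 => //; apply: sub_refl.
- by apply: smallr_sub h5 => //; apply: sub_refl.
- by apply: sparse_sub h6 => //; apply: sub_refl.
Qed.

Lemma sparseHit_le k j w M X S f : j <= k -> sparseHit k w M X S f -> sparseHit j w M X S f.
Proof. by move=> jk [h1 h2 h3 h4 h5 h6]; split=> //; apply: ready_le h1. Qed.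

Lemma grown_hit k w D A SA E Y g : ready k A SA -> anti D SA -> dis D A -> smallr A w D ->
  sub Y A -> sub E D -> into g E Y -> sparse Y w E g -> sparseHit k w E Y SA g.
Proof.
move=> h1 h2 h3 h4 sY sE h5 h6; split=> //.
- by apply: ready_sub h1 => //; apply: sub_refl.
- exact: anti_subl h2.
- exact: dis_sub h3.
- exact: smallr_sub h4.
Qed.

(* [K] hits of rank [k] on [M] with pairwise anticomplete clusters, all contained in [S]. *)
Fixpoint hits k K w M S : Prop :=
  if K is K'.+1 then exists S1 X SX f, [/\ hits k K' w M S1, sparseHit k w M X SX f,
    anti S1 X, anti S1 SX & [/\ sub S1 S, sub X S & sub SX S]]
  else True.

Lemma hits_sub k K w M M' S S' : sub M' M -> sub S S' -> hits k K w M S -> hits k K w M' S'.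
Proof.
elim: K S S' => //= K IH S S' sM sS [S1 [X [SX [f [h1 h2 h3 h4 [s1 s2 s3]]]]]].
exists S1, X, SX, f; split=> //; [|exact: sparseHit_sub h2|].
  by apply: IH h1 => //; apply: sub_refl.
by split; [apply: sub_trans s1 sS|apply: sub_trans s2 sS|apply: sub_trans s3 sS].
Qed.

Lemma hits_le k j K w M S : j <= k -> hits k K w M S -> hits j K w M S.
Proof.
move=> jk; elim: K S => //= K IH S [S1 [X [SX [f [h1 h2 h3 h4 h5]]]]].
by exists S1, X, SX, f; split=> //; [apply: IH|apply: sparseHit_le h2].
Qed.

Lemma hits_leK k K K' w M S : K' <= K -> hits k K w M S -> hits k K' w M S.
Proof.
elim: K S => [|K IH] S; first by rewrite leqn0 => /eqP->.
rewrite leq_eqVlt => /orP[/eqP-> //|]; rewrite ltnS => kk.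
move=> [S1 [X [SX [f [h1 h2 h3 h4 [h5 _ _]]]]]].
by apply: hits_sub (IH _ kk h1) => //; apply: sub_refl.
Qed.

Lemma hits_add k K w M M' S S' X SX f : sub M' M -> hits k K w M S -> sparseHit k w M' X SX f ->
  anti S X -> anti S SX -> sub S S' -> sub X S' -> sub SX S' -> hits k K.+1 w M' S'.
Proof.
move=> sM h1 h2 h3 h4 *; exists S, X, SX, f; split=> //.
by apply: hits_sub h1 => //; apply: sub_refl.
Qed.

(** The trees at [v] and at [f n v] are glued along the edge between these vertices. No other pair
    is adjacent: the second tree leaves [S] only at [f n v], [S] is anticomplete to [M], and [SM] to
    both [X] and [S]. *)
Lemma join k w M SM X S f : ready k M SM -> sparseHit k w M X S f ->
  anti SM X -> anti SM S -> ready k.+1 M (icup SM (icup X S)).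
Proof.
move=> rM [rX aS dX iX _ _] aX aSS n v vM.
have [S0 s0 t0] := rM n v vM; have [fX rf] := iX n v vM; have [S1 s1 t1] := rX n _ fX.
exists (S0 :|: S1).
  rewrite subUset; apply/andP; split.
    by apply: subset_trans s0 _; rewrite setUS ?subsetUl.
  apply: subset_trans s1 _; rewrite subUset sub1set !inE fX /= !orbT /=.
  by rewrite /icup !setUA subsetUr.
exists S0, S1, (f n v); split=> //.
  by move: rf; rewrite /clo => /orP[/eqP ev|//]; case: (dX n v vM); rewrite ev.
move=> a b /(subsetP s0); rewrite !inE => /orP[/eqP->|aSM] /(subsetP s1);
  rewrite !inE => /orP[/eqP->|bS] rab //.
- by move: (aS n v b vM bS); rewrite rab.
- by move: (aX n a _ aSM fX); rewrite rab.
- by move: (aSS n a b aSM bS); rewrite rab.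
Qed.

(** A binomial tree of rank [j + 1] is one of rank [j] with another joined to its root, so each rank
    uses up one hit; the hits have rank [k], which caps [j] at [k + 1]. *)
Lemma ready_hits k j K w M S : j <= K -> j <= k.+1 -> hits k K w M S -> ready j M S.
Proof.
move=> jK jk /(hits_leK jK); elim: j {jK} jk S => [|j IH] jk S; first by move=> _; apply: ready0.
move=> [S1 [X [SX [f [h1 h2 h3 h4 [s1 s2 s3]]]]]].
have h := join (IH (ltnW jk) _ h1) (sparseHit_le (jk : j <= k) h2) h3 h4.
by apply: ready_sub h => //; do !apply: sub_cup.
Qed.

(* [lk_dom] is how coherence enters: a non-infinitesimal part of [M] dominates almost all of [Q]. *)
Record link w M u Q : Prop := Link {
  lk_pos : pos w M;
  lk_posQ : pos u Q;
  lk_small : smallr M w M;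
  lk_smallQ : smallr Q u Q;
  lk_dis : dis M Q;
  lk_cross : smallr M u Q;
  lk_dom : forall Z, sub Z M -> pos w Z -> ~ pos u (idif Q (iN Z)) }.

Lemma idifS A A' B : sub A' A -> sub (idif A' B) (idif A B).
Proof. by move=> s n; apply: setSD. Qed.

Lemma link_sub w M M' u Q Q' : sub M' M -> sub Q' Q -> pos w M' -> pos u Q' ->
  link w M u Q -> link w M' u Q'.
Proof.
move=> sM sQ pM pQ [_ _ h1 h2 h3 h4 h5]; split=> //.
- exact: smallr_sub h1.
- exact: smallr_sub h2.
- exact: dis_sub h3.
- exact: smallr_sub h4.
- move=> Z sZ pZ pD; apply: (h5 Z) => //; first exact: sub_trans sZ sM.
  by apply: pos_sub pD; apply: idifS.
Qed.

Lemma idif_idif_pos w A A' : sub A' A -> pos w A -> ~ pos w (idif A A') -> pos w A'.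
Proof.
move=> sA pA nA; have [] // := @pos_cover _ w A A' (idif A A') _ pA.
by move=> n; apply/subsetP=> x xA; rewrite !inE xA andbT orbN.
Qed.

Lemma link_cov w M u Q A' : link w M u Q -> sub A' M -> ~ pos w (idif M A') ->
  ~ pos u (idif Q (iN A')).
Proof.
by move=> l sA nA; apply: (lk_dom l) => //; apply: idif_idif_pos sA (lk_pos l) nA.
Qed.

(* The property shared by both kinds of hits that lets [X] serve as a source for [grow]. *)
Record coverHit k w D X S : Prop := CoverHit {
  cv_ready : ready k X S;
  cv_anti : anti D S;
  cv_dis : dis D X;
  cv_small : smallr X w D;
  cv_cov : forall D1, sub D1 D -> pos w D1 -> exists rho, [/\ pos rho X, smallr X rho X &
    forall X', sub X' X -> ~ pos rho (idif X X') -> ~ pos w (idif D1 (iN X'))] }.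

(** The image under [f] of the measure [w] restricted to [D]. *)
Definition push w f D : iwt := fun n y => \sum_(x in D n | f n x == y) w n x.
Arguments push w f D n : clear implicits.

Lemma wt_push w f D n (B : {set ver n}) :
  wt (push w f D n) B = wt (w n) [set x in D n | f n x \in B].
Proof.
rewrite /wt /push (exchange_big_dep (mem (D n))) /=; last by move=> i j _ /andP[].
rewrite [RHS](eq_bigl (fun x => (x \in D n) && (f n x \in B))); last by move=> x; rewrite inE.
rewrite [RHS]big_mkcondr; apply: eq_bigr => x xD; case: ifP => fB; last first.
  by rewrite big1 // => y /andP[yB /andP[_ /eqP fy]]; rewrite fy yB in fB.
rewrite (big_pred1 (f n x)) // => y; rewrite xD /= eq_sym.
by case: eqP => [->|]; rewrite ?fB ?andbF.
Qed.

Lemma tot_push w f D n : tot (push w f D) n = wt (w n) (D n).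
Proof. by rewrite /tot wt_push; congr wt; apply/setP=> x; rewrite !inE andbT. Qed.

Lemma pos_push w f D Z : pos w D -> pos (push w f D) Z ->
  pos w (fun n => [set x in D n | f n x \in Z n]).
Proof.
move=> [a pa] [b pb]; exists (a * b); apply: (ultra_and2 Uu _ pa pb) => n.
rewrite tot_push wt_push => h1 h2.
by apply: leq_trans h1 _; rewrite -mulnA leq_mul2l (ltnW h2) orbT.
Qed.

Lemma push_pos w f D X : pos w D -> into f D X -> pos (push w f D) X.
Proof.
move=> [a pa] iX; exists 2; apply: (ultra_imp Uu) pa => n h; rewrite tot_push wt_push.
rewrite (_ : [set x in D n | _] = D n); last first.
  by apply/setP=> x; rewrite !inE; case: (boolP (x \in D n)) => //= /iX[].
by move: h; case: (wt _ _) => [|p]; rewrite ?muln0 // mul2n -addnn; lia.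
Qed.

Lemma push_small w f D D1 X : sub D1 D -> pos w D1 -> sparse X w D f ->
  smallr X (push w f D1) X.
Proof.
move=> sD [a pa] sp k; apply: (ultra_and2 Uu _ pa (sp (k * a))) => n h1 h2 y yX.
rewrite tot_push wt_push; have := h2 y yX => {}h2.
have : a * (k * wt (w n) [set x in D n | r n (f n x) y]) < a * wt (w n) (D1 n).
  by apply: leq_ltn_trans h1; rewrite mulnA [a * k]mulnC.
rewrite ltn_mul2l => /andP[_ /ltnW h3]; apply: leq_trans h3; rewrite leq_mul2l.
apply/orP; right; apply: wtS; apply/subsetP=> x; rewrite 2!in_set => /andP[xD /setIP[]].
by rewrite in_nb1 => h _; rewrite (subP sD xD) (clo_sym (edg_sym n)).
Qed.

(** The measure on [X] is the image of that of [D1]: whatever [X'] leaves uncovered in [D1] is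
    mapped by [f] into [X] outside [X']. *)
Lemma sparseHit_cover k w D X S f : sparseHit k w D X S f -> coverHit k w D X S.
Proof.
case=> h1 h2 h3 h4 h5 h6; split=> // D1 sD pD; exists (push w f D1); split.
- by apply: push_pos => //; apply: into_sub h4 => //; apply: sub_refl.
- exact: push_small h6.
- move=> X' sX nX pX; apply: nX.
  have [k' hk] := pX; exists k'; apply: (ultra_imp Uu) hk => n.
  rewrite tot_push wt_push => h; apply: leq_ltn_trans (wt_tot w D1 n) _.
  apply: leq_trans h _; rewrite leq_mul2l; apply/orP; right; apply: wtS.
  apply/subsetP=> x; rewrite !inE => /andP[nN xD]; rewrite xD /=.
  have [fX rf] := h4 n x (subP sD xD); rewrite fX andbT; apply: contra nN => fX'.
  by apply/exists_inP; exists (f n x); rewrite // (clo_sym (edg_sym n)).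
Qed.

(** The link goes from [X] to [D]: every positive part of [X] still covers almost all of [D], and
    hits received by [X] can be promoted to hits on [D]. *)
Record domHit k w D rho X S : Prop := DomHit {
  dm_ready : ready k X S;
  dm_anti : anti D S;
  dm_link : link rho X w D;
  dm_back : smallr D rho X }.

Lemma domHit_cover k w D rho X S : domHit k w D rho X S -> coverHit k w D X S.
Proof.
case=> h1 h2 h3 h4; split=> //; first by apply: dis_sym (lk_dis h3).
  exact: lk_cross h3.
move=> D1 sD pD; exists rho; split; [exact: lk_pos h3|exact: lk_small h3|].
move=> X' sX nX pX; apply: (link_cov h3 sX nX); apply: pos_sub pX.
exact: idifS.
Qed.

Lemma domHit_sub k w D D' rho X X' S S' : sub D' D -> sub X' X -> sub S S' ->
  pos w D' -> pos rho X' -> anti D' S' -> domHit k w D rho X S -> domHit k w D' rho X' S'.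
Proof.
move=> sD sX sS pD pX aS [h1 h2 h3 h4]; split=> //.
- exact: ready_sub h1.
- exact: link_sub h3.
- exact: smallr_sub h4.
Qed.

(** Adjacent pairs are counted twice. Of the factor [k * k], one [k] is the threshold in [bad] and
    the other bounds the weight of the bad vertices. *)
Lemma fubini w D rho X : pos w D -> smallr X w D ->
  exists D', [/\ sub D' D, pos w D' & smallr D' rho X].
Proof.
move=> pD sX.
have [kap [kapU kapP]] := overspill Uu (fun k => sX (k * k)).
pose bad n v := tot rho n < kap n * wt (rho n) (nb (r n) [set v] :&: X n).
exists (fun n => [set v in D n | ~~ bad n v]); split.
- by move=> n; apply/subsetP=> v; rewrite inE => /andP[].
- apply: (@idif_idif_pos w D) => //; first by move=> n; apply/subsetP=> v; rewrite inE => /andP[].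
  apply/nullP => k; apply: (ultra_and2 Uu _ (kapU 1) (kapU k)) => n k0 kk.
  have {k0} h := kapP n k0.
  set W := idif _ _ n.
  apply: (@leq_trans (kap n * wt (w n) W)); first by rewrite leq_mul2r kk orbT.
  have sW v : v \in W -> (v \in D n) && bad n v.
    by rewrite !inE; case: (v \in D n); rewrite ?andbF //= negbK andbT.
  have main : kap n * (wt (w n) W * tot rho n) <= tot w n * tot rho n.
    apply: (@leq_trans (kap n * (kap n * \sum_(v in D n) w n v * wt (rho n) (nb (r n) [set v] :&: X n)))).
      rewrite leq_mul2l; apply/orP; right; rewrite {1}/wt big_distrl big_distrr /=.
      apply: (@leq_trans (\sum_(v in W) kap n * (w n v * wt (rho n) (nb (r n) [set v] :&: X n)))).
        apply: leq_sum => v /sW /andP[_ /ltnW b]; rewrite mulnCA leq_mul2l b.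
        by rewrite orbT.
      rewrite [leqRHS](big_setID W) /= (_ : D n :&: W = W) ?leq_addr //.
      by apply/setIidPr/subsetP=> v /sW /andP[].
    rewrite mulnA.
    have -> : \sum_(v in D n) w n v * wt (rho n) (nb (r n) [set v] :&: X n) =
              \sum_(y in X n) rho n y * wt (w n) (nb (r n) [set y] :&: D n).
      have e1 v : wt (rho n) (nb (r n) [set v] :&: X n) = \sum_(y in X n) rho n y * r n v y.
        rewrite -wt_indic setIC; congr wt; apply/setP=> y.
        by rewrite 2!in_setI in_nb1 inE.
      have e2 v : wt (w n) (nb (r n) [set v] :&: D n) = \sum_(y in D n) w n y * r n v y.
        rewrite -wt_indic setIC; congr wt; apply/setP=> y.
        by rewrite 2!in_setI in_nb1 inE.
      under eq_bigr => v _ do rewrite e1 big_distrr /=.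
      rewrite exchange_big /=; apply: eq_bigr => y _; rewrite e2 big_distrr /=.
      by apply: eq_bigr => v _; rewrite mulnCA (clo_sym (edg_sym n)).
    rewrite big_distrr /= mulnC [X in _ <= X]mulnC mulnC.
    apply: (@leq_trans (\sum_(y in X n) rho n y * tot w n)).
      by apply: leq_sum => y /h hy; rewrite mulnCA leq_mul2l hy orbT.
    by rewrite -big_distrl /= leq_mul2r; apply/orP; right; apply: (wt_tot rho X).
  case: (posnP (tot rho n)) => [t0|t0].
    rewrite (_ : W = set0) ?/wt ?big_set0 ?muln0 //.
    apply/setP=> v; rewrite in_set0; apply/negP=> /sW/andP[_]; rewrite /bad.
    have : wt (rho n) (nb (r n) [set v] :&: X n) <= tot rho n by apply: wtS; apply: subsetT.
    by rewrite t0 leqn0 => /eqP->; rewrite muln0.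
  by move: main; rewrite mulnA leq_pmul2r.
- move=> k; apply: (ultra_imp Uu) (kapU k) => n kk v; rewrite inE => /andP[_].
  rewrite /bad -leqNgt => h; apply: leq_trans h; by rewrite leq_mul2r kk orbT.
Qed.

(** This lets a block of [D] use its own image in [X] without touching the other blocks. *)
Definition sep w D f := forall D1 D2, sub D1 D -> sub D2 D -> pos w D1 -> pos w D2 ->
  exists E1 E2, [/\ sub E1 D1, sub E2 D2, pos w E1, pos w E2 &
    forall n x y, x \in E1 n -> y \in E2 n -> ~~ r n (f n x) y].

Lemma sep_sub w D D' f : sub D' D -> sep w D f -> sep w D' f.
Proof. by move=> s h D1 D2 s1 s2; apply: h; [apply: sub_trans s1 s|apply: sub_trans s2 s]. Qed.

(* If [f] does not separate, the failing pair [D1], [D2] shows that the image on [X] of the measure of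
   [D1] dominates [D2]; [fubini] discards the vertices of [D2] with a large neighbourhood in [X]. *)
Lemma classify k w D X S f : pos w D -> smallr D w D -> sparseHit k w D X S f ->
  sep w D f \/ exists D' rho, sub D' D /\ domHit k w D' rho X S.
Proof.
move=> pD sD [h1 h2 h3 h4 h5 h6]; apply: contrapT => /not_orP[ns nd]; apply: ns.
move=> D1 D2 s1 s2 p1 p2; apply: contrapT => no; apply: nd.
have sXD : smallr X w D2 by apply: smallr_sub h5 => //; apply: sub_refl.
have [D' [sD' pD' smD']] := fubini (push w f D1) p2 sXD.
have sDD : sub D' D by apply: sub_trans sD' s2.
exists D', (push w f D1); split=> //; split=> //.
- exact: anti_subl h2.
- split=> //.
  + by apply: push_pos => //; apply: into_sub h4 => //; apply: sub_refl.
  + exact: push_small h6.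
  + exact: smallr_sub sD.
  + by apply: dis_sym; apply: dis_subl h3.
  + by apply: smallr_sub sXD => //; apply: sub_refl.
  + move=> Z sZ pZ pN; apply: no.
    exists (fun n => [set x in D1 n | f n x \in Z n]), (idif D' (iN Z)); split.
    * by move=> n; apply/subsetP=> x; rewrite inE => /andP[].
    * by apply: sub_trans sD'; apply: sub_dif.
    * exact: pos_push.
    * exact: pN.
    * move=> n x y; rewrite inE => /andP[_ fZ] yN.
      by rewrite (clo_sym (edg_sym n)); apply: (@anti_dif D' Z n y).
Qed.

(** An inclusion-minimal subset of at least half the weight exceeds half by less than the weight of
    one of its vertices. *)
Lemma halve (T : finType) (w : T -> nat) (D : {set T}) : exists D1 : {set T},
  [/\ D1 \subset D, wt w D <= 2 * wt w D1 &
   forall m, (forall v, v \in D -> w v <= m) -> 2 * wt w D1 <= wt w D + 2 * m].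
Proof.
pose P (B : {set T}) := (B \subset D) && (wt w D <= 2 * wt w B).
have PD : P D by rewrite /P subxx mul2n -addnn leq_addr.
have [D1 /minsetP[/andP[s1 h1] mn] _] := minset_exists PD.
exists D1; split=> // m hm.
case: (set_0Vmem D1) => [->|[v vD1]]; first by rewrite {1}/wt big_set0.
have : ~~ P (D1 :\ v).
  apply/negP=> /mn e; have := e (subD1set _ _) => {}e.
  by move: vD1; rewrite -e !inE eqxx.
rewrite /P (subset_trans (subD1set _ _) s1) /= -ltnNge => h.
have : wt w D1 = w v + wt w (D1 :\ v) by rewrite /wt (big_setD1 v).
have := hm v (subsetP s1 _ vD1); lia.
Qed.

Lemma split_half w D : pos w D -> smallr D w D ->
  exists D1 D2, [/\ sub D1 D, sub D2 D, pos w D1, pos w D2 & dis D1 D2].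
Proof.
move=> [k pk] sD; pose D1 : iset := fun n => projT1 (cid (halve (w n) (D n))).
have h n : [/\ D1 n \subset D n, wt (w n) (D n) <= 2 * wt (w n) (D1 n) &
   forall m, (forall v, v \in D n -> w n v <= m) -> 2 * wt (w n) (D1 n) <= wt (w n) (D n) + 2 * m]
  := projT2 (cid (halve (w n) (D n))).
exists D1, (idif D D1); split.
- by move=> n; case: (h n).
- exact: sub_dif.
- exists (2 * k); apply: (ultra_imp Uu) pk => n hn; case: (h n) => _ h2 _.
  by apply: leq_trans hn _; rewrite [2 * k]mulnC -mulnA leq_mul2l h2 orbT.
- exists (4 * k); apply: (ultra_and2 Uu _ pk (sD (8 * k))) => n hn h8; case: (h n) => s1 _ h2.
  (* A vertex lies in its own closed neighbourhood, so it weighs at most an eighth of [D]. Hence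
     [D1] takes at most 5/8, and at least a quarter is left. *)
  have small v : v \in D n -> 8 * w n v <= wt (w n) (D n).
    move=> vD; have h9 : 8 * k * w n v <= tot w n.
      apply: leq_trans (h8 v vD); rewrite leq_mul2l; apply/orP; right.
      rewrite /wt (bigD1 v) /= ?leq_addr // in_setI in_nb1 clo_refl //.
    have := leq_ltn_trans h9 hn; rewrite [8 * k]mulnC -mulnA ltn_mul2l => /andP[_ /ltnW].
    by [].
  have := h2 (wt (w n) (D n) %/ 8) => {}h2.
  have : 2 * wt (w n) (D1 n) <= wt (w n) (D n) + 2 * (wt (w n) (D n) %/ 8).
    by apply: h2 => v /small; rewrite leq_divRL // mulnC.
  have : wt (w n) (D n) = wt (w n) (D1 n) + wt (w n) (idif D D1 n).
    by rewrite (wtID _ (D n) (D1 n)) (setIidPr s1).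
  move: hn; move: (wt _ (D n)) (wt _ (D1 n)) (wt _ (idif _ _ _)) => a b c hn e h3.
  have h4 : a <= 4 * c by lia.
  by apply: leq_trans hn _; rewrite [4 * k]mulnC -mulnA leq_mul2l h4 orbT.
- by move=> n x x1; rewrite inE x1.
Qed.

Lemma split_parts w R D : pos w D -> smallr D w D -> exists Dp : nat -> iset,
  (forall i, i < R -> sub (Dp i) D /\ pos w (Dp i)) /\
  forall i j, i < R -> j < R -> i <> j -> dis (Dp i) (Dp j).
Proof.
elim: R D => [|R IH] D pD sD; first by exists (fun=> D).
have [D1 [D2 [s1 s2 p1 p2 d12]]] := split_half pD sD.
have [Dp [h1 h2]] := IH D2 p2 (smallr_sub s2 s2 sD).
exists (fun i => if i is i'.+1 then Dp i' else D1); split.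
  by case=> [|i] // /h1[si pi]; split=> //; apply: sub_trans si s2.
have d1 i : i < R -> dis D1 (Dp i) by move=> /h1[si _]; apply: dis_subr si d12.
move=> [|i] [|j] // iR jR ij; [exact: d1|exact/dis_sym/d1|by apply: h2 => // e; apply: ij; rewrite e].
Qed.
End Hits.

Section Games.
Context {G : graph_seq}.
Implicit Types (A B D E M Q X Y S : iset) (w u rho : iwt) (f g : ifun).
Local Notation r n := (clo (edg n)).

(** * Redistributing hits *)

Fixpoint coverHits k K w D S : Prop :=
  if K is K'.+1 then exists S1 X SX, [/\ coverHits k K' w D S1, coverHit k w D X SX,
    anti S1 X, anti S1 SX & [/\ sub S1 S, sub X S & sub SX S]]
  else True.

Lemma hits_coverHits k K w D S : hits k K w D S -> coverHits k K w D S.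
Proof.
elim: K S => //= K IH S [S1 [X [SX [f [h1 h2 h3 h4 h5]]]]].
by exists S1, X, SX; split=> //; [apply: IH|apply: sparseHit_cover h2].
Qed.

(** [C'] is the opposite side, and [S] supports the hits that are still to be spent. *)
Record side k w D S C' i C S1 : Prop := Side {
  sd_sub : sub C D; sd_pos : pos w C; sd_fam : hits k i w C S1;
  sd_anti : anti C' S1; sd_rest : anti S1 S }.

(* Each hit is spent on whichever of [C1], [C2] it covers; the other side avoids it.  By pigeonhole one
   side collects [a] hits. *)
Lemma two_sides_aux a k w K D S C1 C2 S1 S2 i j Sall :
  coverHits k K w D S -> side k w D S C2 i C1 S1 -> side k w D S C1 j C2 S2 ->
  i < a -> j < a -> 2 * a <= (i + j + K).+1 -> sub S Sall -> sub S1 Sall -> sub S2 Sall ->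
  exists A B SA, [/\ sub A C1 /\ sub B C2 \/ sub A C2 /\ sub B C1, pos w A /\ pos w B,
    hits k a w A SA, sub SA Sall & anti B SA].
Proof.
elim: K S C1 C2 S1 S2 i j => [|K IH] S C1 C2 S1 S2 i j; first by move=> *; lia.
move=> [S' [X [SX [hK hX aX aSX [sS' sX sSX]]]]].
move=> d1 d2 ia ja le sS s1 s2.
have [rho [pX smX cov]] := cv_cov hX (sd_sub d1) (sd_pos d1).
pose C t := if t is 0 then C1 else C2.
have [//|t t2|t t2|//|] := @grow _ 2 X rho C (fun=> w) _ pX smX.
- by case: t t2 => [|t] _; [apply: sd_pos d1|apply: sd_pos d2].
- apply: smallr_sub (cv_small hX); first exact: sub_refl.
  by case: t t2 => [|t] _; [apply: sd_sub d1|apply: sd_sub d2].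
move=> Y [t [E [g [sYX [t2 sE pE] iE spE others]]]].
(* By symmetry the side that was hit may be called [C1]. *)
suff key : forall C1 C2 S1 S2 i j, side k w D S C2 i C1 S1 -> side k w D S C1 j C2 S2 ->
    i < a -> j < a -> 2 * a <= (i + j + K.+1).+1 -> sub S1 Sall -> sub S2 Sall ->
    sub E C1 -> pos w (idif C2 (iN Y)) ->
    exists A B SA, [/\ sub A C1 /\ sub B C2 \/ sub A C2 /\ sub B C1, pos w A /\ pos w B,
      hits k a w A SA, sub SA Sall & anti B SA].
  case: t t2 sE {pE spE} => [|t] t2 sE; first by apply: (key _ _ _ _ _ _ d1 d2) => //; apply: (others 1).
  have [|A [B [SA [o *]]]] := key _ _ _ _ _ _ d2 d1 ja ia _ s2 s1 sE (others 0 isT).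
    by rewrite [j + i]addnC.
  by exists A, B, SA; split=> //; case: o; [right|left].
move=> {C1 C2 S1 S2 i j d1 d2 ia ja le s1 s2 cov others sE C}.
move=> C1 C2 S1 S2 i j d1 d2 ia ja le s1 s2 sE p2.
have {}pE : pos w E by move: pE; case: (t).
have {}spE : sparse Y w E g by move: spE; case: (t).
have sED : sub E D by apply: sub_trans sE (sd_sub d1).
pose SA := icup S1 (icup Y SX).
have hit := grown_hit (cv_ready hX) (cv_anti hX) (cv_dis hX) (cv_small hX) sYX sED iE spE.
have famE : hits k i.+1 w E SA.
  apply: (hits_add sE (sd_fam d1) hit).
  - by apply: anti_subr (sd_rest d1); apply: sub_trans sYX sX.
  - by apply: anti_subr (sd_rest d1).
  - exact: sub_cupl.
  - by apply: sub_trans (sub_cupl _ _) (sub_cupr _ _).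
  - by apply: sub_trans (sub_cupr _ _) (sub_cupr _ _).
have sSA : sub SA Sall.
  apply: sub_cup => //; apply: sub_cup; apply: sub_trans sS => //.
  exact: sub_trans sYX sX.
have aB : anti (idif C2 (iN Y)) SA.
  apply: anti_cupr; first by apply: anti_subl (sd_anti d1); apply: sub_dif.
  apply: anti_cupr; first exact: anti_dif.
  apply: anti_subl (cv_anti hX); apply: sub_trans (sub_dif _ _) (sd_sub d2).
case: (ltnP i.+1 a) => [ia'|ia']; last first.
  have e : i.+1 = a by apply/eqP; rewrite eqn_leq ia.
  by exists E, (idif C2 (iN Y)), SA; split; rewrite -?e //; left; split=> //; apply: sub_dif.
have [||||||||A [B [SB [o *]]]] := IH S' E (idif C2 (iN Y)) SA S2 i.+1 j hK.
- split=> //; apply: anti_cupl; first by apply: anti_subr (sd_rest d1).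
  apply: anti_cupl; last exact: anti_sym.
  by apply/anti_sym; apply: anti_subr aX.
- split=> //.
  + exact: sub_trans (sub_dif _ _) (sd_sub d2).
  + by apply: hits_sub (sd_fam d2); [apply: sub_dif|apply: sub_refl].
  + exact: anti_subl (sd_anti d2).
  + exact: anti_subr (sd_rest d2).
- exact: ia'.
- exact: ja.
- by move: le; rewrite addSn addnS.
- exact: sub_trans sS' sS.
- exact: sSA.
- exact: s2.
exists A, B, SB; split=> //; case: o => [[o1 o2]|[o1 o2]]; [left|right]; split=> //.
- exact: sub_trans sE.
- exact: sub_trans (sub_dif _ _).
- exact: sub_trans (sub_dif _ _).
- exact: sub_trans sE.
Qed.

Definition inil : iset := fun n => set0.

Lemma anti_nil A : anti A inil. Proof. by move=> n x y _; rewrite inE. Qed.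
Lemma sub_nil A : sub inil A. Proof. by move=> n; apply: sub0set. Qed.

(** [2 a - 1] hits suffice: while both sides hold at most [a - 1], one is left to spend. *)
Lemma two_sides a k w K D S D1 D2 : 0 < a -> 2 * a <= K.+1 -> coverHits k K w D S ->
  sub D1 D -> sub D2 D -> pos w D1 -> pos w D2 ->
  exists A B SA, [/\ sub A D1 /\ sub B D2 \/ sub A D2 /\ sub B D1, pos w A /\ pos w B,
    hits k a w A SA, sub SA S & anti B SA].
Proof.
move=> a0 aK h s1 s2 p1 p2.
have sd D' C : sub C D -> pos w C -> side k w D S D' 0 C inil.
  by move=> s p; split=> //; [apply: anti_nil|apply/anti_sym/anti_nil].
apply: (two_sides_aux h (sd D2 D1 s1 p1) (sd D1 D2 s2 p2) a0 a0) => //.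
- exact: sub_nil.
- exact: sub_nil.
Qed.

(** * Promotion and gathering *)

Definition promotes k K' K := forall M w Q u S Sall, link w M u Q -> hits k K w M S ->
  anti Q S -> sub S Sall -> sub M Sall ->
  exists Q', [/\ sub Q' Q, pos u Q' & hits k.+1 K' u Q' Sall].
Definition promotable k K' := exists K, promotes k K' K.

(** Here and in [promotes], [Sall] bounds the place of the new hits, so that whatever is
    anticomplete to it remains so in later games. *)
Definition gathers k K' N := forall M w Q u (Mi Si : nat -> iset) Sall (I : seq nat),
  link w M u Q -> sub M Sall -> uniq I -> N <= size I ->
  (forall i, i \in I ->
    [/\ sub (Mi i) M, pos w (Mi i), ready k (Mi i) (Si i), anti Q (Si i) & sub (Si i) Sall]) ->
  (forall i j, i \in I -> j \in I -> i != j ->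
    [/\ dis (Mi i) (Mi j), anti (Mi i) (Si j) & anti (Si i) (Si j)]) ->
  exists Q', [/\ sub Q' Q, pos u Q' & hits k K' u Q' Sall].
Definition gatherable k K' := exists N, gathers k K' N.

Lemma promotes_mono k K' K K1 : K <= K1 -> promotes k K' K -> promotes k K' K1.
Proof. by move=> KK h M w Q u S Sall l f; apply: h l (hits_leK KK f). Qed.

(* [Si i] carries the trees of block [i], and [Fi i] the [h i] hits it has received so far. *)
Record blocks k w M Q SQ Sall (I : seq nat) (Mi Si Fi : nat -> iset) (h : nat -> nat) : Prop :=
 Blocks {
  bk_sub : forall i, i \in I -> sub (Mi i) M;
  bk_pos : forall i, i \in I -> pos w (Mi i);
  bk_ready : forall i, i \in I -> ready k (Mi i) (Si i);
  bk_fam : forall i, i \in I -> hits k (h i) w (Mi i) (Fi i);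
  bk_SF : forall i, i \in I -> anti (Si i) (Fi i);
  bk_Q : forall i, i \in I -> anti Q (icup (Si i) (Fi i));
  bk_SQM : forall i, i \in I -> anti SQ (Mi i);
  bk_SQG : forall i, i \in I -> anti SQ (icup (Si i) (Fi i));
  bk_all : forall i, i \in I -> sub (icup (Si i) (Fi i)) Sall;
  bk_dis : forall i j, i \in I -> j \in I -> i != j -> dis (Mi i) (Mi j);
  bk_MG : forall i j, i \in I -> j \in I -> i != j -> anti (Mi i) (icup (Si j) (Fi j));
  bk_GG : forall i j, i \in I -> j \in I -> i != j ->
    anti (icup (Si i) (Fi i)) (icup (Si j) (Fi j)) }.

Lemma sum_upd (I : seq nat) j0 h : uniq I ->
  \sum_(j <- I) (if j == j0 then (h j).+1 else h j) = \sum_(j <- I) h j + (j0 \in I).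
Proof.
move=> uI; have -> : (j0 \in I : nat) = \sum_(j <- I) (j == j0).
  by rewrite -count_uniq_mem // -sum1_count big_mkcond; apply: eq_bigr => j _ /=; case: eqP.
rewrite -big_split /=.
by apply: eq_bigr => j _; case: eqP => _; rewrite ?addn1 ?addn0.
Qed.

(* Each move uses a block without hits as a source; [size I + q + \sum h] never drops, so when no such
   block is left, many blocks have a hit and hence carry trees of rank [k + 1]. *)
Lemma gather_game k K' KF N1 : promotes k K' KF -> gathers k.+1 K' N1 ->
  forall M w u Sall z Q SQ (I : seq nat) (Mi Si Fi : nat -> iset) (h : nat -> nat) q,
  size I <= z -> link w M u Q -> sub M Sall -> sub SQ Sall -> uniq I ->
  hits k q u Q SQ -> q < K' -> (forall i, i \in I -> h i < KF) ->
  K' + KF.+1 * N1 <= size I + q + \sum_(i <- I) h i ->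
  blocks k w M Q SQ Sall I Mi Si Fi h ->
  exists Q', [/\ sub Q' Q, pos u Q' & hits k K' u Q' Sall].
Proof.
move=> hF hE M w u Sall; elim=> [|z IH] Q SQ I Mi Si Fi h q.
  by rewrite leqn0 size_eq0 => /eqP-> _ _ _ _ _ qK _; rewrite big_nil /=; lia.
move=> sz l sM sSQ uI fQ qK hKF bd bk.
case: (boolP (has (fun i => h i == 0) I)) => [|/hasPn all1]; last first.
  (* Each block adds at most [KF + 1] to [size I] plus the sum of [h], and [q < K']. *)
  have szN : N1 <= size I.
    have : \sum_(i <- I) h i <= \sum_(i <- I) KF.
      by rewrite big_seq [leqRHS]big_seq; apply: leq_sum => i /hKF/ltnW.
    rewrite big_const_seq count_predT iter_addn_0 => hs.
    have : K' + KF.+1 * N1 <= size I * KF.+1 + q by rewrite mulnS; lia.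
    by move=> hh; rewrite leqNgt; apply/negP => h1; have := leq_mul h1 (leqnn KF.+1); lia.
  have [||Q' [s p f]] := hE M w Q u Mi (fun i => icup (Si i) (Fi i)) Sall I l sM uI szN.
  - move=> i iI; split.
    + exact: (bk_sub bk).
    + exact: (bk_pos bk).
    + have h1 : 1 <= h i by rewrite lt0n; apply: all1.
      have [_ [X [SX [f [_ hit _ _ [_ sX sSX]]]]]] := hits_leK h1 (bk_fam bk iI).
      have aSF := bk_SF bk iI.
      have hj := join (bk_ready bk iI) hit (anti_subr sX aSF) (anti_subr sSX aSF).
      apply: ready_sub hj; first exact: sub_refl.
      by apply: sub_cup (sub_cupl _ _) _; apply: sub_trans (sub_cupr _ _); apply: sub_cup.
    + exact: (bk_Q bk).
    + exact: (bk_all bk).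
  - by move=> i j iI jI ij; split; [apply: (bk_dis bk)|apply: (bk_MG bk)|apply: (bk_GG bk)].
  by exists Q'; split=> //; apply: hits_le f.
case/hasP=> b bI /eqP hb; pose I' := rem b I.
have uI' : uniq I' by apply: rem_uniq.
have memI' j : (j \in I') = (j != b) && (j \in I) by rewrite mem_rem_uniq.
have sI' : size I' = (size I).-1 by apply: size_rem.
have sI0 : 0 < size I by case: (I) bI.
have sumI : \sum_(i <- I) h i = \sum_(i <- I') h i by rewrite (big_rem b) //= hb.
(* Target 0 is [Q], which the source is known to dominate; the others are the remaining blocks. *)
pose tg t := if t is t'.+1 then Mi (nth 0 I' t') else Q.
pose tw t := if t is t'.+1 then w else u.
have nI' t : t < size I' -> nth 0 I' t \in I by move/(mem_nth 0); rewrite memI' => /andP[].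
have pb := bk_pos bk bI; have sb := bk_sub bk bI.
have [//|||||Y [t [E [g [sY [tm sE pE] iE spE others]]]]] :=
    @grow _ (size I').+1 (Mi b) w tg tw _ pb.
- exact: smallr_sub (lk_small l).
- case=> [|t] tm; first exact: lk_posQ l.
  by apply: (bk_pos bk); apply: nI'.
- case=> [|t] tm; first by apply: smallr_sub (lk_cross l) => //; apply: sub_refl.
  by apply: smallr_sub (lk_small l) => //; apply: (bk_sub bk); apply: nI'.
- move=> A' sA' nA'; apply: (lk_dom l); first exact: sub_trans sb.
  exact: idif_idif_pos pb nA'.
pose Z := icup Y (Si b).
have sYM : sub Y M by apply: sub_trans sY sb.
have sSb : sub (Si b) (icup (Si b) (Fi b)) by apply: sub_cupl.
have sZ : sub Z Sall.
  by apply: sub_cup; [apply: sub_trans sYM sM|apply: sub_trans sSb (bk_all bk bI)].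
have GZ j : j \in I' -> anti (icup (Si j) (Fi j)) Z.
  rewrite memI' => /andP[jb jI]; apply: anti_cupr.
    by apply/anti_sym; apply: anti_subl sY _; apply: (bk_MG bk) => //; rewrite eq_sym.
  by apply: anti_subr sSb _; apply: (bk_GG bk).
have SQZ : anti SQ Z.
  apply: anti_cupr; first by apply: anti_subr sY _; apply: (bk_SQM bk).
  by apply: anti_subr sSb _; apply: (bk_SQG bk).
have QSb : anti Q (Si b) by apply: anti_subr sSb _; apply: (bk_Q bk).
have MZ j D : j \in I' -> sub D (Mi j) -> anti D Y -> anti D Z.
  rewrite memI' => /andP[jb jI] sD aD; apply: anti_cupr => //.
  by apply: anti_sub sD sSb _; apply: (bk_MG bk).
case: t tm sE pE spE => [|t] tm sE pE spE.
  have hit : sparseHit k u E Y (Si b) g.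
    apply: (grown_hit (bk_ready bk bI) QSb _ _ sY sE iE spE).
      by apply/dis_sym; apply: dis_subl (lk_dis l).
    by apply: smallr_sub (lk_cross l) => //; apply: sub_refl.
  have fE : hits k q.+1 u E (icup SQ Z).
    apply: (hits_add sE fQ hit).
    + by apply: anti_subr SQZ; apply: sub_cupl.
    + by apply: anti_subr SQZ; apply: sub_cupr.
    + exact: sub_cupl.
    + by apply: sub_trans (sub_cupr _ _); apply: sub_cupl.
    + by apply: sub_trans (sub_cupr _ _); apply: sub_cupr.
  have sQZ : sub (icup SQ Z) Sall by apply: sub_cup.
  case: (ltnP q.+1 K') => qK'; last first.
    have e : q.+1 = K' by apply/eqP; rewrite eqn_leq qK.
    by exists E; split=> //; rewrite -e; apply: hits_sub fE => //; apply: sub_refl.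
  pose Mi' j := idif (Mi j) (iN Y).
  have sMi' j : sub (Mi' j) (Mi j) by apply: sub_dif.
  have [||||||||||Q' [s p f]] := IH E (icup SQ Z) I' Mi' Si Fi h q.+1 => //.
  - by rewrite sI'; lia.
  - by apply: (link_sub _ _ _ _ l) => //; apply: lk_pos l.
  - by move=> i; rewrite memI' => /andP[_ /hKF].
  - by move: bd; rewrite sI' -sumI; lia.
  - have II i : i \in I' -> i \in I by rewrite memI' => /andP[].
    split=> [i /II iI|i iI|i /II iI|i /II iI|i /II iI|i /II iI|i iI|i iI|i /II iI|
             i j /II iI /II jI ij|i j /II iI /II jI ij|i j /II iI /II jI ij].
    + by apply: sub_trans (bk_sub bk iI).
    + have := others (index i I').+1; rewrite /= nth_index //; apply.
      by rewrite ltnS index_mem.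
    + by apply: ready_sub (bk_ready bk iI) => //; apply: sub_refl.
    + by apply: hits_sub (bk_fam bk iI) => //; apply: sub_refl.
    + exact: (bk_SF bk).
    + by apply: anti_subl (bk_Q bk iI).
    + apply: anti_cupl; first by apply: anti_subr (bk_SQM bk (II _ iI)).
      by apply/anti_sym; apply: (MZ i) => //; apply: anti_dif.
    + by apply: anti_cupl; [apply: (bk_SQG bk (II _ iI))|apply/anti_sym/GZ].
    + exact: (bk_all bk).
    + by apply: dis_sub (bk_dis bk iI jI ij).
    + by apply: anti_subl (bk_MG bk iI jI ij).
    + exact: (bk_GG bk).
  by exists Q'; split=> //; apply: sub_trans sE.
set j0 := nth 0 I' t in sE.
have j0I' : j0 \in I' by apply: mem_nth.
have II i : i \in I' -> i \in I by rewrite memI' => /andP[].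
have j0I := II _ j0I'.
have j0b : j0 != b by move: j0I'; rewrite memI' => /andP[].
have hit : sparseHit k w E Y (Si b) g.
  apply: (grown_hit (bk_ready bk bI) _ _ _ sY sE iE spE).
  - by apply: anti_subr sSb _; apply: (bk_MG bk).
  - exact: (bk_dis bk).
  - by apply: smallr_sub (lk_small l) => //; apply: (bk_sub bk).
pose Fj := icup (Fi j0) Z.
have FZ : anti (Fi j0) Z by apply: anti_subl (GZ _ j0I'); apply: sub_cupr.
have fE : hits k (h j0).+1 w E Fj.
  apply: (hits_add sE (bk_fam bk j0I) hit).
  - by apply: anti_subr FZ; apply: sub_cupl.
  - by apply: anti_subr FZ; apply: sub_cupr.
  - exact: sub_cupl.
  - by apply: sub_trans (sub_cupr _ _); apply: sub_cupl.
  - by apply: sub_trans (sub_cupr _ _); apply: sub_cupr.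
pose Q1 := idif Q (iN Y).
have sQ1 : sub Q1 Q by apply: sub_dif.
have pQ1 : pos u Q1 by apply: (others 0).
have Q1Z : anti Q1 Z by apply: anti_cupr; [apply: anti_dif|apply: anti_subl QSb].
have Q1F : anti Q1 Fj.
  by apply: anti_cupr => //; apply: anti_sub sQ1 _ (bk_Q bk j0I); apply: sub_cupr.
have sFj : sub Fj Sall.
  by apply: sub_cup => //; apply: sub_trans (bk_all bk j0I); apply: sub_cupr.
have sEM : sub E M by apply: sub_trans sE (bk_sub bk j0I).
(* Once block [j0] holds [KF] hits, promotion from it to [Q1] ends the game, with a rank to
   spare. *)
case: (ltnP (h j0).+1 KF) => hj0; last first.
  have e : (h j0).+1 = KF by apply/eqP; rewrite eqn_leq hKF.
  have [|||Q' [s p f]] := hF E w Q1 u Fj Sall _ _ Q1F sFj.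
  - exact: link_sub l.
  - by rewrite -e.
  - exact: sub_trans sM.
  by exists Q'; split=> //; [apply: sub_trans sQ1|apply: hits_le f].
pose Mi' j := if j == j0 then E else idif (Mi j) (iN Y).
pose Fi' j := if j == j0 then Fj else Fi j.
pose h' j := if j == j0 then (h j).+1 else h j.
have sMi' j : sub (Mi' j) (Mi j) by rewrite /Mi'; case: eqP => [->|_] //; apply: sub_dif.
have sFi' j D : (j == j0 -> anti D Z) -> anti D (icup (Si j) (Fi j)) ->
    anti D (icup (Si j) (Fi' j)).
  rewrite /Fi'; case: eqP => [->|_] // aZ aG; apply: anti_cupr.
    by apply: anti_subr aG; apply: sub_cupl.
  apply: anti_cupr; last exact: aZ.
  by apply: anti_subr aG; apply: sub_cupr.
have MZ' j : j \in I' -> j != j0 -> anti (Mi' j) Z.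
  move=> jI' jj; apply: (MZ j) => //; rewrite /Mi' (negPf jj); exact: anti_dif.
have [||||||||||Q' [s p f]] := IH Q1 SQ I' Mi' Si Fi' h' q => //.
- by rewrite sI'; lia.
- by apply: (link_sub _ _ _ _ l) => //; apply: lk_pos l.
- by apply: hits_sub fQ => //; apply: sub_refl.
- by move=> i /II iI; rewrite /h'; case: eqP => [->|_] //; apply: hKF.
- by move: bd; rewrite /h' sum_upd // j0I' sI' -sumI; lia.
- split=> [i /II iI|i iI|i /II iI|i /II iI|i /II iI|i /II iI|i /II iI|i /II iI|i /II iI|
           i j /II iI /II jI ij|i j iI jI ij|i j iI jI ij].
  + by apply: sub_trans (bk_sub bk iI).
  + rewrite /Mi'; case: eqP => [_|_] //.
    have := others (index i I').+1; rewrite /= nth_index //; apply.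
    by rewrite ltnS index_mem.
  + by apply: ready_sub (bk_ready bk iI) => //; apply: sub_refl.
  + rewrite /Mi' /Fi' /h'; case: eqP => [->|_] //.
    by apply: hits_sub (bk_fam bk iI); [apply: sub_dif|apply: sub_refl].
  + rewrite /Fi'; case: eqP => [->|_]; last exact: (bk_SF bk).
    apply: anti_cupr; first exact: (bk_SF bk).
    by apply: anti_subl (GZ _ j0I'); apply: sub_cupl.
  + by apply: (sFi') => [_|] //; apply: anti_subl (bk_Q bk iI).
  + by apply: anti_subr (bk_SQM bk iI).
  + by apply: (sFi') => [_|] //; apply: (bk_SQG bk).
  + rewrite /Fi'; case: eqP => [e|_]; last exact: (bk_all bk).
    by apply: sub_cup => //; apply: sub_trans (bk_all bk iI); apply: sub_cupl.
  + by apply: dis_sub (bk_dis bk iI jI ij).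
  + apply: (sFi') => [/eqP e|]; first by apply: MZ' => //; rewrite -e.
    by apply: anti_subl (bk_MG bk (II _ iI) (II _ jI) ij).
  + have aGG := bk_GG bk (II _ iI) (II _ jI) ij.
    apply: (sFi') => [/eqP e|].
      rewrite /Fi' -e (negPf ij); exact: GZ.
    apply/anti_sym/sFi' => [/eqP e|]; last exact/anti_sym.
    by apply: GZ.
by exists Q'; split=> //; apply: sub_trans sQ1.
Qed.

Lemma gather_step k : (forall K', promotable k K') -> (forall K', gatherable k.+1 K') -> forall K', gatherable k K'.
Proof.
move=> hF hE K'; case: (posnP K') => [->|K0].
  by exists 0 => M w Q u Mi Si Sall I l *; exists Q; split=> //; apply: lk_posQ l.
have [K0' hF0] := hF K'; have [N1 hE1] := hE K'.
(* The successor makes the threshold positive, so that blocks without hits are below it at the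
   start. *)
have hF1 : promotes k K' K0'.+1 := promotes_mono (leqnSn _) hF0.
exists (K' + K0'.+2 * N1) => M w Q u Mi Si Sall I l sM uI szI hI hII.
apply: (gather_game hF1 hE1 (leqnn (size I)) l sM (sub_nil _) uI (q := 0) (h := fun=> 0)
  (Mi := Mi) (Si := Si) (Fi := fun=> inil) (SQ := inil)) => //.
  by rewrite addn0 big1_eq addn0.
have nilU S : sub (icup S inil) S by move=> n; rewrite /icup setU0.
split=> [i /hI[]|i /hI[]|i /hI[]|i _|i _|i /hI[_ _ _ h _]|i _|i _|i /hI[_ _ _ _ h]|
  i j iI jI ij|i j iI jI ij|i j iI jI ij] //.
- exact: anti_nil.
- exact: anti_subr h.
- exact/anti_sym/anti_nil.
- exact/anti_sym/anti_nil.
- exact: sub_trans h.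
- by have [] := hII i j iI jI ij.
- by have [_ h _] := hII i j iI jI ij; apply: anti_subr h.
- by have [_ _ h] := hII i j iI jI ij; apply: anti_sub h.
Qed.
End Games.

Section Config.
Context {G : graph_seq}.
Implicit Types (D M Q Y : iset) (w u : iwt) (g : ifun).
Local Notation r n := (clo (edg n)).

Definition upd (V : Type) (F : nat -> V) z v : nat -> V := fun i => if i == z then v else F i.

Lemma updE (V : Type) (F : nat -> V) z v : upd F z v z = v.
Proof. by rewrite /upd eqxx. Qed.

Lemma upd_neq (V : Type) (F : nat -> V) z v i : i != z -> upd F z v i = F i.
Proof. by rewrite /upd => /negPf->. Qed.

Definition bigicup (I : seq nat) (F : nat -> iset) : iset := foldr (fun i B => icup (F i) B) inil I.

Lemma bigicup_anti I F B : (forall i, i \in I -> anti B (F i)) -> anti B (bigicup I F).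
Proof.
elim: I => [|i I IH] h /=; first exact: anti_nil.
apply: anti_cupr; first by apply: h; rewrite mem_head.
by apply: IH => j jI; apply: h; rewrite inE jI orbT.
Qed.

Lemma bigicup_sub I F B : (forall i, i \in I -> sub (F i) B) -> sub (bigicup I F) B.
Proof.
elim: I => [|i I IH] h /=; first exact: sub_nil.
apply: sub_cup; first by apply: h; rewrite mem_head.
by apply: IH => j jI; apply: h; rewrite inE jI orbT.
Qed.

Definition cluster (X S : nat -> iset) i := icup (X i) (S i).

Lemma bigicup_coverHits k w D (X S : nat -> iset) I : uniq I ->
  (forall i, i \in I -> coverHit k w D (X i) (S i)) ->
  (forall i j, i \in I -> j \in I -> i != j -> anti (cluster X S i) (cluster X S j)) ->
  coverHits k (size I) w D (bigicup I (cluster X S)).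
Proof.
elim: I => //= i I IH /andP[iI uI] hc hp.
have hi j : j \in I -> anti (cluster X S j) (cluster X S i).
  move=> jI; apply: hp; rewrite ?inE ?eqxx ?jI ?orbT //.
  by apply: contraNneq iI => <-.
exists (bigicup I (cluster X S)), (X i), (S i); split.
- apply: IH => // [j jI|j j' jI jI']; first by apply: hc; rewrite inE jI orbT.
  by apply: hp; rewrite inE ?jI ?jI' orbT.
- by apply: hc; rewrite mem_head.
- by apply/anti_sym/bigicup_anti => j /hi; move/anti_sym; apply: anti_subl; apply: sub_cupl.
- by apply/anti_sym/bigicup_anti => j /hi; move/anti_sym; apply: anti_subl; apply: sub_cupr.
- split; first exact: sub_cupr.
  + by apply: sub_trans (sub_cupl _ _); apply: sub_cupl.
  + by apply: sub_trans (sub_cupl _ _); apply: sub_cupr.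
Qed.

Lemma bigicup_hits k w D (X S : nat -> iset) (f : nat -> ifun) I : uniq I ->
  (forall i, i \in I -> sparseHit k w D (X i) (S i) (f i)) ->
  (forall i j, i \in I -> j \in I -> i != j -> anti (cluster X S i) (cluster X S j)) ->
  hits k (size I) w D (bigicup I (cluster X S)).
Proof.
elim: I => //= i I IH /andP[iI uI] hc hp.
have hi j : j \in I -> anti (cluster X S j) (cluster X S i).
  move=> jI; apply: hp; rewrite ?inE ?eqxx ?jI ?orbT //.
  by apply: contraNneq iI => <-.
exists (bigicup I (cluster X S)), (X i), (S i), (f i); split.
- apply: IH => // [j jI|j j' jI jI']; first by apply: hc; rewrite inE jI orbT.
  by apply: hp; rewrite inE ?jI ?jI' orbT.
- by apply: hc; rewrite mem_head.
- by apply/anti_sym/bigicup_anti => j /hi; move/anti_sym; apply: anti_subl; apply: sub_cupl.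
- by apply/anti_sym/bigicup_anti => j /hi; move/anti_sym; apply: anti_subl; apply: sub_cupr.
- split; first exact: sub_cupr.
  + by apply: sub_trans (sub_cupl _ _); apply: sub_cupl.
  + by apply: sub_trans (sub_cupl _ _); apply: sub_cupr.
Qed.

(** * From rank k to rank k + 1 *)

(* Items with index in [J] are dominating hits of rank [k], in [A] dominating hits of rank [k + 1], and
   in [P] separating hits; [lv i] counts the hits of rank [k + 1] that item [i] has itself received, and
   [q] those received by [Qc]. *)
Record config k w u Q Sall q D Qc SQ (J A P : seq nat) (X S : nat -> iset) (f : nat -> ifun)
    (rho : nat -> iwt) (lv : nat -> nat) : Prop := Cfg {
  cf_link : link w D u Qc;
  cf_subQ : sub Qc Q;
  cf_fam : hits k.+1 q u Qc SQ;
  cf_SQ : sub SQ Sall;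
  cf_SQD : anti SQ D;
  cf_uniq : uniq (J ++ A ++ P);
  cf_dom : forall i, i \in J ++ A -> domHit k w D (rho i) (X i) (S i);
  cf_lev : forall i, i \in J ++ A -> hits k.+1 (lv i) (rho i) (X i) (S i);
  cf_A : forall i, i \in A -> ready k.+1 (X i) (S i);
  cf_sep : forall i, i \in P -> sparseHit k w D (X i) (S i) (f i) /\ sep w D (f i);
  cf_Q : forall i, i \in J ++ A ++ P -> anti Qc (cluster X S i);
  cf_SQc : forall i, i \in J ++ A ++ P -> anti SQ (cluster X S i);
  cf_all : forall i, i \in J ++ A ++ P -> sub (cluster X S i) Sall;
  cf_pair : forall i j, i \in J ++ A ++ P -> j \in J ++ A ++ P -> i != j ->
    anti (cluster X S i) (cluster X S j) }.

Lemma cluster_sub (X X' S : nat -> iset) i : sub (X' i) (X i) -> sub (cluster X' S i) (cluster X S i).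
Proof. by move=> s n; apply: setSU. Qed.

Section ConfigChanges.
Variables (k : nat) (w u : iwt) (Q Sall : iset).

(** A dominating item may shrink to any positive part. A separating one has no measure of its own;
    it only has to keep the image of [D']. *)
Lemma config_sub q D D' Qc Qc' SQ J J' A P X X' S f rho lv :
  config k w u Q Sall q D Qc SQ J A P X S f rho lv ->
  sub D' D -> sub Qc' Qc -> pos w D' -> pos u Qc' -> uniq (J' ++ A ++ P) -> {subset J' <= J} ->
  (forall i, i \in J' ++ A -> sub (X' i) (X i) /\ pos (rho i) (X' i)) ->
  (forall i, i \in P -> sub (X' i) (X i) /\ into (f i) D' (X' i)) ->
  config k w u Q Sall q D' Qc' SQ J' A P X' S f rho lv.
Proof.
move=> c sD sQ pD pQ uI sJ hd hs.
have m1 i : i \in J' ++ A -> i \in J ++ A.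
  by rewrite !mem_cat => /orP[/sJ->|->]; rewrite ?orbT.
have m2 i : i \in J' ++ A ++ P -> i \in J ++ A ++ P /\ sub (cluster X' S i) (cluster X S i).
  rewrite !mem_cat orbA => /orP[iJ|iP].
    have iJ' : i \in J' ++ A by rewrite mem_cat.
    have [s _] := hd i iJ'; split; last exact: cluster_sub.
    by move: (m1 _ iJ'); rewrite mem_cat orbA => ->.
  by have [s _] := hs i iP; split; [rewrite iP !orbT|apply: cluster_sub].
split=> //.
- exact: (link_sub sD sQ pD pQ (cf_link c)).
- exact: sub_trans sQ (cf_subQ c).
- by apply: hits_sub sQ _ (cf_fam c); apply: sub_refl.
- exact: (cf_SQ c).
- exact: anti_subr sD (cf_SQD c).
- move=> i iI; have [s p] := hd i iI; apply: (domHit_sub sD s _ pD p _ (cf_dom c (m1 _ iI))).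
    exact: sub_refl.
  exact: anti_subl sD (dm_anti (cf_dom c (m1 _ iI))).
- move=> i iI; have [s p] := hd i iI.
  by apply: hits_sub s _ (cf_lev c (m1 _ iI)); apply: sub_refl.
- move=> i iA; have [|s _] := hd i; first by rewrite mem_cat iA orbT.
  by apply: ready_sub s _ (cf_A c iA); apply: sub_refl.
- move=> i iP; have [s h] := hs i iP; have [[h1 h2 h3 h4 h5 h6] h7] := cf_sep c iP.
  split; last exact: sep_sub sD h7.
  split=> //.
  + by apply: ready_sub s _ h1; apply: sub_refl.
  + exact: anti_subl sD h2.
  + exact: dis_sub sD s h3.
  + exact: smallr_sub s sD h5.
  + exact: sparse_sub s sD h6.
- by move=> i /m2[iI s]; apply: anti_sub sQ s (cf_Q c iI).
- by move=> i /m2[iI s]; apply: anti_subr s (cf_SQc c iI).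
- by move=> i /m2[iI s]; apply: sub_trans s (cf_all c iI).
- by move=> i j /m2[iI s] /m2[jI s'] ij; apply: anti_sub s s' (cf_pair c iI jI ij).
Qed.

Lemma config_all Sall' q D Qc SQ J A P X S f rho lv : sub Sall Sall' ->
  config k w u Q Sall q D Qc SQ J A P X S f rho lv ->
  config k w u Q Sall' q D Qc SQ J A P X S f rho lv.
Proof.
move=> s c; split; try by case: c.
- exact: sub_trans (cf_SQ c) s.
- by move=> i /(cf_all c) h; apply: sub_trans h s.
Qed.

Lemma add_Q q D Qc SQ J A P X S f rho lv Y SA g :
  config k w u Q Sall q D Qc SQ J A P X S f rho lv ->
  sparseHit k.+1 u Qc Y SA g -> anti SQ (icup Y SA) -> anti (icup Y SA) D ->
  (forall i, i \in J ++ A ++ P -> anti (icup Y SA) (cluster X S i)) -> sub (icup Y SA) Sall ->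
  config k w u Q Sall q.+1 D Qc (icup SQ (icup Y SA)) J A P X S f rho lv.
Proof.
move=> c hit aZ aD aI sZ; split; try by case: c.
- apply: (hits_add (sub_refl _) (cf_fam c) hit).
  + by apply: anti_subr aZ; apply: sub_cupl.
  + by apply: anti_subr aZ; apply: sub_cupr.
  + exact: sub_cupl.
  + by apply: sub_trans (sub_cupr _ _); apply: sub_cupl.
  + by apply: sub_trans (sub_cupr _ _); apply: sub_cupr.
- exact: sub_cup (cf_SQ c) sZ.
- exact: anti_cupl (cf_SQD c) aD.
- by move=> i iI; apply: anti_cupl (cf_SQc c iI) (aI _ iI).
Qed.

(** The received hit is stored in [S h0], so every later demand on the cluster of [h0] includes
    it. *)
Lemma add_X h0 q D Qc SQ J A P X S f rho lv Y SA g :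
  config k w u Q Sall q D Qc SQ J A P X S f rho lv -> h0 \in J ++ A ->
  sparseHit k.+1 (rho h0) (X h0) Y SA g -> anti SQ (icup Y SA) -> anti D (icup Y SA) ->
  anti Qc (icup Y SA) -> anti (S h0) (icup Y SA) ->
  (forall i, i \in J ++ A ++ P -> i != h0 -> anti (cluster X S i) (icup Y SA)) ->
  sub (icup Y SA) Sall ->
  config k w u Q Sall q D Qc SQ J A P X (upd S h0 (icup (S h0) (icup Y SA))) f rho
    (upd lv h0 (lv h0).+1).
Proof.
move=> c hI hit aSQ aD aQ aS aI sZ; set Z := icup Y SA in aSQ aD aQ aS aI sZ *.
set S' := upd _ _ _.
have nP i : i \in P -> i != h0.
  move=> iP; apply: contraTneq (cf_uniq c) => e; move: hI; rewrite -e => hI.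
  rewrite catA cat_uniq negb_and; apply/orP; right; rewrite negb_and; apply/orP; left.
  by rewrite negbK; apply/hasP; exists i.
have sS i : sub (S i) (S' i).
  by rewrite /S' /upd; case: eqP => [->|_] //; apply: sub_cupl.
have cl' D' i : (i = h0 -> anti D' Z) -> anti D' (cluster X S i) -> anti D' (cluster X S' i).
  rewrite /cluster /S' /upd; case: eqP => [->|_] //= aZ aC; apply: anti_cupr.
    by apply: anti_subr aC; apply: sub_cupl.
  apply: anti_cupr; last exact: aZ.
  by apply: anti_subr aC; apply: sub_cupr.
have hI3 : h0 \in J ++ A ++ P by rewrite catA mem_cat hI.
split; try by case: c.
- move=> i iI; have [h1 h2 h3 h4] := cf_dom c iI; split=> //.
    by apply: ready_sub (sS i) h1; apply: sub_refl.
  by rewrite /S' /upd; case: eqP => [e|_] //; apply: anti_cupr; rewrite -?e.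
- move=> i iI; have := cf_lev c iI; rewrite /S' /upd; case: eqP => [->|_] // h.
  apply: (hits_add (sub_refl _) h hit).
  + by apply: anti_subr aS; apply: sub_cupl.
  + by apply: anti_subr aS; apply: sub_cupr.
  + exact: sub_cupl.
  + by apply: sub_trans (sub_cupr _ _); apply: sub_cupl.
  + by apply: sub_trans (sub_cupr _ _); apply: sub_cupr.
- by move=> i iA; apply: ready_sub (sS i) (cf_A c iA); apply: sub_refl.
- by move=> i iP; rewrite /S' upd_neq ?nP //; apply: (cf_sep c).
- by move=> i iI; apply: (cl') => //; apply: (cf_Q c).
- by move=> i iI; apply: (cl') => //; apply: (cf_SQc c).
- move=> i iI; have := cf_all c iI; rewrite /cluster /S' /upd; case: eqP => [->|_] // h.
  apply: sub_cup; first by apply: sub_trans h; apply: sub_cupl.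
  by apply: sub_cup sZ; apply: sub_trans h; apply: sub_cupr.
- move=> i j iI jI ij; apply: (cl') => [e|].
    apply: anti_sym; apply: (cl') => [e'|]; first by rewrite e e' eqxx in ij.
    by apply/anti_sym/aI; rewrite // -e.
  apply: anti_sym; apply: (cl') => [e|]; last by apply: (cf_pair c) => //; rewrite eq_sym.
  by apply: aI => //; rewrite -e eq_sym.
Qed.

Lemma fresh (I : seq nat) : exists z, z \notin I.
Proof.
exists (\max_(i <- I) i).+1; apply/negP=> h.
by have := @leq_bigmax_seq _ I xpredT id _ h isT; rewrite ltnn.
Qed.

Lemma cluster_upd X S z X0 S0 i : cluster (upd X z X0) (upd S z S0) i = upd (cluster X S) z (icup X0 S0) i.
Proof. by rewrite /cluster /upd; case: eqP. Qed.

Lemma add_item q D Qc SQ J A P J' A' P' X S f rho lv z X0 S0 f0 rho0 :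
  config k w u Q Sall q D Qc SQ J A P X S f rho lv ->
  z \notin J ++ A ++ P -> uniq (J' ++ A' ++ P') ->
  {subset J' ++ A' <= z :: (J ++ A)} -> {subset A' <= z :: A} -> {subset P' <= z :: P} ->
  (z \in J' ++ A' -> domHit k w D rho0 X0 S0) -> (z \in A' -> ready k.+1 X0 S0) ->
  (z \in P' -> sparseHit k w D X0 S0 f0 /\ sep w D f0) ->
  anti Qc (icup X0 S0) -> anti SQ (icup X0 S0) ->
  (forall i, i \in J ++ A ++ P -> anti (cluster X S i) (icup X0 S0)) -> sub (icup X0 S0) Sall ->
  config k w u Q Sall q D Qc SQ J' A' P' (upd X z X0) (upd S z S0) (upd f z f0) (upd rho z rho0)
    (upd lv z 0).
Proof.
move=> c zI uI sJA sA sP hd hr hs aQ aSQ aI sZ.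
have mem i : i \in J' ++ A' ++ P' -> i = z \/ i != z /\ i \in J ++ A ++ P.
  move=> iI; case: (eqVneq i z) => [->|iz]; [by left|right; split=> //].
  move: iI; rewrite !catA !(mem_cat _ (_ ++ _)) => /orP[/sJA|/sP]; rewrite inE (negPf iz) /= => ->.
    by [].
  by rewrite orbT.
split; try by case: c.
- move=> i iI; case: (eqVneq i z) => [e|iz]; first by rewrite e !updE; apply: hd; rewrite -e.
  rewrite !upd_neq //; apply: (cf_dom c).
  by move: (sJA _ iI); rewrite inE (negPf iz).
- move=> i iI; case: (eqVneq i z) => [e|iz]; first by rewrite e !updE.
  rewrite !upd_neq //; apply: (cf_lev c).
  by move: (sJA _ iI); rewrite inE (negPf iz).
- move=> i iI; case: (eqVneq i z) => [e|iz]; first by rewrite e !updE; apply: hr; rewrite -e.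
  rewrite !upd_neq //; apply: (cf_A c).
  by move: (sA _ iI); rewrite inE (negPf iz).
- move=> i iI; case: (eqVneq i z) => [e|iz]; first by rewrite e !updE; apply: hs; rewrite -e.
  rewrite !upd_neq //; apply: (cf_sep c).
  by move: (sP _ iI); rewrite inE (negPf iz).
- by move=> i /mem[->|[iz iI]]; rewrite cluster_upd ?updE // upd_neq //; apply: (cf_Q c).
- by move=> i /mem[->|[iz iI]]; rewrite cluster_upd ?updE // upd_neq //; apply: (cf_SQc c).
- by move=> i /mem[->|[iz iI]]; rewrite cluster_upd ?updE // upd_neq //; apply: (cf_all c).
- move=> i j /mem[->|[iz iI]] /mem[->|[jz jI]] ij; rewrite !cluster_upd ?updE ?eqxx // in ij *.
  + by rewrite upd_neq //; apply/anti_sym/aI.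
  + by rewrite upd_neq //; apply: aI.
  + by rewrite !upd_neq //; apply: (cf_pair c).
Qed.

Definition state M q s J A lv := exists D Qc SQ P X S f rho,
  [/\ config k w u Q Sall q D Qc SQ J A P X S f rho lv, sub D M & size P = s].

(** The new hit is classified: if separating, it is stored in [P] at rank [k] only; if dominating,
    [D] shrinks and the item enters [A] with its full rank. Its level starts at 0. *)
Lemma add_new M q D Qc SQ J A P X S f rho lv Y SA g :
  config k w u Q Sall q D Qc SQ J A P X S f rho lv -> sub D M ->
  sparseHit k.+1 w D Y SA g -> anti Qc (icup Y SA) -> anti SQ (icup Y SA) ->
  (forall i, i \in J ++ A ++ P -> anti (cluster X S i) (icup Y SA)) -> sub (icup Y SA) Sall ->
  exists z, z \notin J ++ A /\ (state M q (size P).+1 J A (upd lv z 0) \/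
    state M q (size P) J (z :: A) (upd lv z 0)).
Proof.
move=> c sM hit aQ aSQ aI sZ; have [z zI] := fresh (J ++ A ++ P).
have l := cf_link c; have uI := cf_uniq c.
have zJA : z \notin J ++ A by apply: contra zI; rewrite catA => h; rewrite mem_cat h.
exists z; split=> //.
have [hs|[D' [rho0 [sD dm]]]] := classify (lk_pos l) (lk_small l) hit.
  left; exists D, Qc, SQ, (z :: P), (upd X z Y), (upd S z SA), (upd f z g), (upd rho z w).
  split=> //; apply: (add_item c zI) => //.
  - by rewrite catA -cat1s uniq_catCA /= -catA zI.
  - by move=> i iI; rewrite inE iI orbT.
  - by move=> i iI; rewrite inE iI orbT.
  - by rewrite (negPf zJA).
  - by move=> zA; move: zJA; rewrite mem_cat zA orbT.
  - by split=> //; apply: sparseHit_le hit.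
right.
have c' : config k w u Q Sall q D' Qc SQ J A P X S f rho lv.
  apply: (config_sub c sD (sub_refl _) _ (lk_posQ l) uI) => //.
  - exact: lk_posQ (dm_link dm).
  - by move=> i iI; split=> //; apply: lk_pos (dm_link (cf_dom c iI)).
  - move=> i iI; split=> //; have [h _] := cf_sep c iI.
    by apply: into_sub sD _ (st_into h); apply: sub_refl.
exists D', Qc, SQ, P, (upd X z Y), (upd S z SA), (upd f z g), (upd rho z rho0).
split=> //; last exact: sub_trans sD sM.
have zP : z \notin P by apply: contra zI => h; rewrite !mem_cat h !orbT.
apply: (add_item c' zI) => //.
- by rewrite -cat1s -[(_ ++ A) ++ P]catA uniq_catCA /= zI.
- by move=> i; rewrite !(mem_cat, inE) orbCA.
- by move=> i iI; rewrite inE iI orbT.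
- by case: dm => h1 h2 h3 h4 _; split=> //; apply: ready_le h1.
- by move=> _; apply: (dm_ready dm).
- by move=> h; rewrite h in zP.
Qed.
End ConfigChanges.
End Config.

(** * Exploiting separating items, and one step of the descent *)

Section Descent.
Context {G : graph_seq}.
Implicit Types (D M Q Y : iset) (w u : iwt) (g : ifun).
Local Notation r n := (clo (edg n)).

Definition img g D : iset := fun n => g n @: D n.
Definition antif g D Y := forall n x y, x \in D n -> y \in Y n -> ~~ r n (g n x) y.

Lemma antif_sub D' Y' g D Y : sub D D' -> sub Y Y' -> antif g D' Y' -> antif g D Y.
Proof. by move=> sD sY h n x y xD yY; apply: h; [apply: (subP sD)|apply: (subP sY)]. Qed.

Lemma img_anti g D Y : antif g D Y -> anti (img g D) Y.
Proof. by move=> h n x y /imsetP[z zD ->] yY; apply: h. Qed.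

Lemma img_sub g D Y : into g D Y -> sub (img g D) Y.
Proof. by move=> h n; apply/subsetP=> x /imsetP[z /h[zY _] ->]. Qed.

Lemma into_img g D D' Y : sub D' D -> into g D Y -> into g D' (img g D).
Proof.
move=> s h n x /(subP s) xD; split; last by case: (h n x xD).
exact: imset_f.
Qed.

Lemma sep_shrink w D (f : nat -> ifun) (P : seq nat) A B : (forall i, i \in P -> sep w D (f i)) ->
  sub A D -> sub B D -> pos w A -> pos w B ->
  exists A' B', [/\ sub A' A, sub B' B, pos w A', pos w B' &
    forall i, i \in P -> antif (f i) B' A'].
Proof.
elim: P A B => [|i P IH] A B hs sA sB pA pB; first by exists A, B; split.
have [//|A1 [B1 [sA1 sB1 pA1 pB1 h1]]] := IH A B _ sA sB pA pB.
  by move=> j jP; apply: hs; rewrite inE jP orbT.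
have [||E1 [E2 [s1 s2 p1 p2 h]]] := hs i (mem_head _ _) B1 A1 _ _ pB1 pA1.
- exact: sub_trans sB1 sB.
- exact: sub_trans sA1 sA.
exists E2, E1; split=> //; [exact: sub_trans s2 sA1|exact: sub_trans s1 sB1|].
move=> j; rewrite inE => /orP[/eqP-> //|/h1]; exact: antif_sub.
Qed.

(** An entry [(a, b, i)] of the list demands that the image of part [a] under [f i] avoid part [b].
    Demands are met one at a time and survive further shrinking. *)
Lemma parts_shrink w D (f : nat -> ifun) (P : seq nat) R (l : seq (nat * nat * nat)) (Dp : nat -> iset) :
  (forall i, i \in P -> sep w D (f i)) ->
  (forall t, t < R -> sub (Dp t) D /\ pos w (Dp t)) ->
  (forall x, x \in l -> [/\ x.1.1 < R, x.1.2 < R, x.1.1 != x.1.2 & x.2 \in P]) ->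
  exists Dp', (forall t, t < R -> sub (Dp' t) (Dp t) /\ pos w (Dp' t)) /\
    forall x, x \in l -> antif (f x.2) (Dp' x.1.1) (Dp' x.1.2).
Proof.
move=> hs hD; elim: l => [|[[a b] i] l IH] hl.
  by exists Dp; split=> // t /hD[_ h]; split.
have [|Dq [h1 h2]] := IH; first by move=> x xl; apply: hl; rewrite inE xl orbT.
have [/= aR bR ab iP] := hl _ (mem_head _ _).
have sD t : t < R -> sub (Dq t) D.
  by move=> tR; apply: sub_trans (proj1 (h1 t tR)) (proj1 (hD t tR)).
have [E1 [E2 [s1 s2 p1 p2 h]]] := hs i iP _ _ (sD a aR) (sD b bR) (proj2 (h1 a aR)) (proj2 (h1 b bR)).
pose Dr := upd (upd Dq a E1) b E2.
have sr t : sub (Dr t) (Dq t).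
  by rewrite /Dr /upd; case: eqP => [->|_] //; case: eqP => [->|_].
exists Dr; split=> [t tR|x].
  split; first by apply: sub_trans (sr t) (proj1 (h1 t tR)).
  rewrite /Dr /upd; case: eqP => _ //; case: eqP => _ //; exact: (proj2 (h1 t tR)).
rewrite inE => /orP[/eqP-> /=|/h2]; last exact: antif_sub.
by rewrite /Dr updE upd_neq // updE.
Qed.

(** The hits are classified one at a time; a dominating answer shrinks [D], which the items found
    before survive. *)
Lemma config_init k w u M Q K S : link w M u Q -> hits k K w M S -> anti Q S ->
  exists D J P X S' f rho lv, [/\ config k w u Q S 0 D Q inil J [::] P X S' f rho lv, sub D M,
    size J + size P = K & forall i, i \in J -> lv i = 0].
Proof.
move=> l; elim: K S => [|K IH] S.
  move=> _ _; exists M, [::], [::], (fun=> inil), (fun=> inil), (fun=> fun n x => x), (fun=> w), (fun=> 0).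
  by split=> //; split=> //; [apply: sub_nil|apply/anti_sym/anti_nil].
move=> [S1 [X0 [SX [f0 [fK hit aX aS [sS1 sX sSX]]]]]] aQ.
have [D [J [P [X [S' [f [rho [lv [c sD szK lv0]]]]]]]]] := IH S1 fK (anti_subr sS1 aQ).
have hitD := sparseHit_sub sD hit; have l' := cf_link c.
have aI i : i \in J ++ [::] ++ P -> anti (cluster X S' i) (icup X0 SX).
  by move=> /(cf_all c) s; apply: anti_subl s (anti_cupr aX aS).
have {}c := config_all sS1 c.
have sZ : sub (icup X0 SX) S by apply: sub_cup.
have aQZ : anti Q (icup X0 SX) by apply: anti_subr sZ aQ.
have [z zI] := fresh (J ++ [::] ++ P).
have [zJ zP] : z \notin J /\ z \notin P by move: zI; rewrite mem_cat negb_or => /andP[].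
have uI := cf_uniq c; have aN : anti inil (icup X0 SX) by apply/anti_sym/anti_nil.
have [hs|[D' [rho0 [sD' dm]]]] := classify (lk_pos l') (lk_small l') hitD.
  exists D, J, (z :: P), (upd X z X0), (upd S' z SX), (upd f z f0), (upd rho z w), (upd lv z 0).
  split=> //.
  - apply: (add_item c zI) => //.
    + by rewrite /= -cat1s uniq_catCA /= zI.
    + by move=> i; rewrite cats0 => iI; rewrite inE iI orbT.
    + by rewrite cats0 (negPf zJ).
  - by rewrite /= addnS szK.
  - by move=> i iJ; rewrite upd_neq ?lv0 //; apply: contraNneq zJ => <-.
have c' : config k w u Q S 0 D' Q inil J [::] P X S' f rho lv.
  apply: (config_sub c sD' (sub_refl _) _ (lk_posQ l) uI) => //.
  - exact: lk_posQ (dm_link dm).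
  - by move=> i iI; split=> //; apply: lk_pos (dm_link (cf_dom c iI)).
  - move=> i iI; split=> //; have [h _] := cf_sep c iI.
    by apply: into_sub sD' _ (st_into h); apply: sub_refl.
exists D', (z :: J), P, (upd X z X0), (upd S' z SX), (upd f z f0), (upd rho z rho0), (upd lv z 0).
split=> //.
- apply: (add_item c' zI) => //.
  + by rewrite /= -/(uniq (J ++ P)) zI.
  + by move=> i iP; rewrite inE iP orbT.
  + by move=> h; rewrite h in zP.
- exact: sub_trans sD' sD.
- by rewrite /= addSn szK.
- move=> i; rewrite inE; case: (eqVneq i z) => [->|iz] /= iJ; first by rewrite updE.
  by rewrite upd_neq ?lv0.
Qed.

Section Step.
Variables (k : nat) (w u : iwt) (Q Sall : iset) (M : iset).
Hypothesis sM : sub M Sall.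

(* The [2k + 1] hits in [J1] are spent to give half of the root set trees of rank [k + 1]; that half then
   grows against [Qc], the other half, and all remaining items. *)
Lemma config_step q s J J1 J2 A lv : state k w u Q Sall M q s J A lv -> perm_eq (J1 ++ J2) J ->
  size J1 = (2 * k).+1 ->
  [\/ state k w u Q Sall M q.+1 s J2 A lv,
     exists2 h0, h0 \in J2 ++ A & state k w u Q Sall M q s J2 A (upd lv h0 (lv h0).+1)
   | exists z, z \notin J2 ++ A /\ (state k w u Q Sall M q s.+1 J2 A (upd lv z 0) \/
       state k w u Q Sall M q s J2 (z :: A) (upd lv z 0))].
Proof.
move=> [D [Qc [SQ [P [X [S [f [rho [c sDM <-]]]]]]]]] pJ sz1; have l := cf_link c.
have uA : uniq ((J1 ++ J2) ++ A ++ P).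
  by rewrite (perm_uniq (perm_cat pJ (perm_refl _))); apply: (cf_uniq c).
have uI : uniq (J2 ++ A ++ P) by move: uA; rewrite -catA cat_uniq => /and3P[].
have uJ1 : uniq J1 by move: uA; rewrite -catA cat_uniq => /and3P[].
have mJ : J1 ++ J2 =i J by apply: perm_mem.
have m1 i : i \in J1 -> i \in J ++ A by move=> h; rewrite mem_cat -mJ mem_cat h.
have m1' i : i \in J1 -> i \in J ++ A ++ P by move/m1 => h; rewrite catA mem_cat h.
have m2 i : i \in J2 ++ A -> i \in J ++ A.
  by rewrite !mem_cat -mJ mem_cat => /orP[]->; rewrite ?orbT.
have m2' i : i \in J2 ++ A ++ P -> i \in J ++ A ++ P.
  by rewrite !mem_cat -mJ mem_cat => /or3P[]->; rewrite ?orbT.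
have m12 i j : i \in J2 ++ A ++ P -> j \in J1 -> i != j.
  move=> iI jJ; apply: contraTneq uA => e; rewrite -catA cat_uniq negb_and; apply/orP; right.
  by rewrite negb_and; apply/orP; left; rewrite negbK; apply/hasP; exists i; rewrite // e.
have nP i : i \in J2 ++ A -> i \notin P.
  move=> iI; apply/negP=> iP; move: uI; rewrite catA cat_uniq => /and3P[_ /negP h _].
  by apply: h; apply/hasP; exists i.
have aDS i : i \in J ++ A ++ P -> anti D (S i).
  rewrite catA mem_cat => /orP[/(cf_dom c)[] //|/(cf_sep c)[[] //]].
have [D1 [D2 [s1 s2 p1 p2 d12]]] := split_half (lk_pos l) (lk_small l).
have cf : coverHits k (size J1) w D (bigicup J1 (cluster X S)).
  apply: bigicup_coverHits => // [i /m1 iI|i j /m1' iI /m1' jI]; first exact: domHit_cover (cf_dom c iI).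
  exact: (cf_pair c).
(* Of [2k + 1] hits, [k + 1] end on one side, just enough for trees of rank [k + 1]. *)
have [||A0 [B0 [SA [sAB [pA0 pB0] fA0 sSA aB0]]]] := @two_sides _ k.+1 k w _ D _ D1 D2 _ _ cf s1 s2 p1 p2.
- by [].
- by rewrite sz1; lia.
have [sA0 sB0 dAB] : [/\ sub A0 D, sub B0 D & dis A0 B0].
  case: sAB => [[a b]|[a b]]; split; try by [apply: sub_trans a _|apply: sub_trans b _].
    exact: dis_sub a b d12.
  by apply/dis_sym; apply: dis_sub b a d12.
(* The images of [B1] must avoid the future source [A1], so that separating items survive the
   growth. *)
have [|A1 [B1 [sA1 sB1 pA1 pB1 afs]]] := @sep_shrink w D f P A0 B0 _ sA0 sB0 pA0 pB0.
  by move=> i /(cf_sep c)[].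
have sAD := sub_trans sA1 sA0; have sBD := sub_trans sB1 sB0.
have rdy : ready k.+1 A1 SA.
  by apply: ready_hits (leqnn _) (leqnn _) (hits_sub sA1 (sub_refl _) fA0).
have aB : anti B1 SA by apply: anti_subl sB1 aB0.
have {dAB}dAB : dis B1 A1 by apply/dis_sym; apply: dis_sub sA1 sB1 dAB.
have aSA B : (forall i, i \in J1 -> anti B (cluster X S i)) -> anti B SA.
  by move=> h; apply: anti_subr sSA (bigicup_anti h).
pose I2 := J2 ++ A.
pose tg t := match t with 0 => Qc | 1 => B1 | t'.+2 => X (nth 0 I2 t') end.
pose tw t := match t with 0 => u | 1 => w | t'.+2 => rho (nth 0 I2 t') end.
have nI t : t.+2 < (size I2).+2 -> nth 0 I2 t \in J ++ A.
  by move=> h; apply/m2/mem_nth.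
have [//|||||Y [t [E [g [sY [tm sE pE] iE spE others]]]]] :=
    @grow _ (size I2).+2 A1 w tg tw _ pA1.
- exact: smallr_sub (lk_small l).
- case=> [|[|t]] tm //; first exact: lk_posQ l.
  by apply: lk_pos (dm_link (cf_dom c (nI _ tm))).
- case=> [|[|t]] tm.
  + by apply: smallr_sub (lk_cross l) => //; apply: sub_refl.
  + exact: smallr_sub (lk_small l).
  + by apply: smallr_sub (dm_back (cf_dom c (nI _ tm))) => //; apply: sub_refl.
- move=> A' sA' nA'; apply: (lk_dom l); first exact: sub_trans sAD.
  exact: idif_idif_pos pA1 nA'.
pose Z := icup Y SA; have sYD := sub_trans sY sAD.
have sZ : sub Z Sall.
  apply: sub_cup; first exact: sub_trans sYD (sub_trans sDM sM).
  by apply: sub_trans sSA _; apply: bigicup_sub => i /m1' /(cf_all c).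
have aSQ : anti SQ Z.
  apply: anti_cupr; first exact: anti_subr sYD (cf_SQD c).
  by apply: aSA => i /m1' /(cf_SQc c).
have aQSA : anti Qc SA by apply: aSA => i /m1' /(cf_Q c).
have clZ i D' : i \in J2 ++ A ++ P -> sub D' (X i) -> anti D' Y -> anti (icup D' (S i)) Z.
  move=> iI sD' aD'.
  have aS : anti (cluster X S i) SA.
    by apply: aSA => j jJ; apply: (cf_pair c); [apply: m2'|apply: m1'|apply: m12].
  apply: anti_cupl; apply: anti_cupr => //.
  - by apply: anti_subl aS; apply: sub_trans sD' (sub_cupl _ _).
  - by apply: anti_sym; apply: anti_subl sYD (aDS _ (m2' _ iI)).
  - by apply: anti_subl aS; apply: sub_cupr.
(* A separating item keeps the image of [B1], which avoids [Y]; a dominating one keeps what the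
   growth left uncovered, which is still positive. *)
pose X1 i := if i \in P then img (f i) B1 else idif (X i) (iN Y).
have sX1 i : i \in J2 ++ A ++ P -> sub (X1 i) (X i).
  rewrite /X1; case: ifP => iP _; last exact: sub_dif.
  have [h _] := cf_sep c iP; apply: img_sub.
  by apply: into_sub sBD _ (st_into h); apply: sub_refl.
have aX1 i : anti (X1 i) Y.
  rewrite /X1; case: ifP => iP; last exact: anti_dif.
  by apply: anti_subr sY (img_anti (afs _ iP)).
have pX1 i : i \in J2 ++ A -> pos (rho i) (X1 i).
  move=> iI; rewrite /X1 (negPf (nP _ iI)).
  have := others (index i I2).+2; rewrite /= nth_index //; apply.
  by rewrite !ltnS index_mem.
have mP i : i \in P -> i \in J2 ++ A ++ P by move=> h; rewrite !mem_cat h !orbT.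
have mI i : i \in J2 ++ A -> i \in J2 ++ A ++ P by move=> h; rewrite catA mem_cat h.
have subJ : {subset J2 <= J} by move=> i h; rewrite -mJ mem_cat h orbT.
have hd1 i : i \in J2 ++ A -> sub (X1 i) (X i) /\ pos (rho i) (X1 i).
  by move=> iI; split; [apply/sX1/mI|apply: pX1].
have hs1 D' i : sub D' B1 -> i \in P -> sub (X1 i) (X i) /\ into (f i) D' (X1 i).
  move=> sD' iP; split; first by apply/sX1/mP.
  rewrite /X1 iP; apply: into_img sD' _.
  by have [h _] := cf_sep c iP; apply: into_sub sBD (sub_refl _) (st_into h).
have clX1 i : i \in J2 ++ A ++ P -> anti (cluster X1 S i) Z.
  by move=> iI; apply: clZ => //; apply: sX1.
pose Q1 := idif Qc (iN Y); have sQ1 : sub Q1 Qc by apply: sub_dif.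
have pQ1 : pos u Q1 by apply: (others 0).
have aQ1 : anti Q1 Z by apply: anti_cupr; [apply: anti_dif|apply: anti_subl aQSA].
pose B2 := idif B1 (iN Y); have sB2 : sub B2 B1 by apply: sub_dif.
have pB2 : pos w B2 by apply: (others 1).
have aB2 : anti B2 Z by apply: anti_cupr; [apply: anti_dif|apply: anti_subl aB].
have sB2D := sub_trans sB2 sBD.
(* Target 0 gives [Qc] a hit, target 1 creates a new item on a part of [B1], and any other target
   raises the level of an item. *)
case: t tm sE pE spE => [|[|t]] tm sE pE spE.
- apply: Or31; exists B2, E, (icup SQ Z), P, X1, S, f, rho; split=> //; last first.
    exact: sub_trans sB2D sDM.
  have c1 := config_sub c sB2D sE pB2 pE uI subJ hd1 (fun i => hs1 _ i sB2).
  apply: (add_Q c1 (g := g)) => //.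
  + apply: (grown_hit rdy aQSA _ _ sY sE iE spE).
      by apply/dis_sym; apply: dis_subl sAD (lk_dis l).
    by apply: smallr_sub (lk_cross l) => //; apply: sub_refl.
  + exact: anti_sym.
  + by move=> i iI; apply/anti_sym/clX1.
- apply: Or33.
  have c1 := config_sub c (sub_trans sE sBD) sQ1 pE pQ1 uI subJ hd1 (fun i => hs1 _ i sE).
  apply: (add_new c1 (g := g)) => //.
  + exact: sub_trans (sub_trans sE sBD) sDM.
  + apply: (grown_hit rdy aB dAB _ sY sE iE spE).
    exact: smallr_sub (lk_small l).
  + exact: aQ1.
  + exact: aSQ.
  + exact: clX1.
  + exact: sZ.
set h0 := nth 0 I2 t in sE pE spE.
have hI : h0 \in J2 ++ A by apply: mem_nth.
constructor 2; exists h0 => //.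
pose X2 := upd X1 h0 E.
have hP i : i \in P -> i != h0 by move=> iP; apply: contraNneq (nP _ hI) => <-.
exists B2, Q1, SQ, P, X2, (upd S h0 (icup (S h0) Z)), f, rho; split=> //; last first.
  exact: sub_trans sB2D sDM.
have c1 : config k w u Q Sall q B2 Q1 SQ J2 A P X2 S f rho lv.
  apply: (config_sub c sB2D sQ1 pB2 pQ1 uI subJ).
    move=> i iI; rewrite /X2 /upd; case: eqP => [->|_] //; exact: hd1.
  by move=> i iP; rewrite /X2 upd_neq ?hP //; apply: hs1.
have dh := cf_dom c (m2 _ hI).
apply: (add_X c1 (g := g)) => //.
- rewrite /X2 updE; apply: (grown_hit rdy _ _ _ sY (sub_refl _) iE spE).
  + apply: anti_subl (sub_trans sE (sub_cupl _ (S h0))) _; apply: aSA => j jJ.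
    by apply: (cf_pair c); [apply/m2'/mI|apply: m1'|apply/m12: jJ; apply: mI].
  + by apply: dis_sub sE sAD (lk_dis (dm_link dh)).
  + exact: smallr_sub sAD sE (dm_back dh).
- by apply: anti_subl (clX1 _ (mI _ hI)); apply: sub_cupr.
- by move=> i iI ih; rewrite /cluster /X2 upd_neq //; apply: clX1.
Qed.

End Step.
End Descent.

(** * Endings of the descent, the potential argument and the climb *)

Section Final.
Context {G : graph_seq}.
Implicit Types (D M Q Y : iset) (w u : iwt) (g : ifun).
Local Notation r n := (clo (edg n)).

Section Ends.
Variables (k : nat) (w u : iwt) (Q Sall : iset) (M : iset) (K' : nat).
Hypothesis sM : sub M Sall.
Local Notation goal := (exists Q', [/\ sub Q' Q, pos u Q' & hits k.+1 K' u Q' Sall]).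
Local Notation st := (state k w u Q Sall M).

Lemma end_exit q s J A lv : st q s J A lv -> K' <= q -> goal.
Proof.
move=> [D [Qc [SQ [P [X [S [f [rho [c _ _]]]]]]]]] qK; exists Qc; split.
- exact: cf_subQ c.
- exact: lk_posQ (cf_link c).
- exact: hits_leK qK (hits_sub (sub_refl _) (cf_SQ c) (cf_fam c)).
Qed.

(** [two_sides] converts dominating hits into sparse ones; both sides are taken equal to [D] because
    only the winner is kept. Promotion then gives rank [k + 2], one more than required. *)
Lemma end_dom a q s J A lv : promotes k.+1 K' a -> 0 < a -> 2 * a <= (size A).+1 ->
  st q s J A lv -> goal.
Proof.
move=> hF a0 aA [D [Qc [SQ [P [X [S [f [rho [c sD _]]]]]]]]]; have l := cf_link c.
have mA i : i \in A -> i \in J ++ A by move=> h; rewrite mem_cat h orbT.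
have mA' i : i \in A -> i \in J ++ A ++ P by move=> h; rewrite !mem_cat h orbT.
have uA : uniq A by have := cf_uniq c; rewrite !cat_uniq => /and3P[_ _ /and3P[]].
have h : coverHits k.+1 (size A) w D (bigicup A (cluster X S)).
  apply: bigicup_coverHits => // [i iA|i j /mA' iA /mA' jA]; last exact: (cf_pair c).
  have [h1 h2 h3 h4] := cf_dom c (mA _ iA).
  by apply: (@domHit_cover _ _ _ _ (rho i)); split=> //; apply: (cf_A c).
have [B [B' [SA [sB [pB _] fB sSA _]]]] :=
  two_sides a0 aA h (sub_refl _) (sub_refl _) (lk_pos l) (lk_pos l).
have {}sB : sub B D by case: sB => [[h1 _]|[h1 _]].
have [||||Q' [s' p' f']] := hF B w Qc u SA Sall _ fB.
- exact: link_sub sB (sub_refl _) pB (lk_posQ l) l.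
- by apply: anti_subr sSA (bigicup_anti _) => i /mA' /(cf_Q c).
- by apply: sub_trans sSA (bigicup_sub _) => i /mA' /(cf_all c).
- exact: sub_trans sB (sub_trans sD sM).
exists Q'; split=> //; first exact: sub_trans s' (cf_subQ c).
exact: hits_le (leqnSn _) f'.
Qed.

(* Here the roles are exchanged: item [i] passes its hits back to the root set. *)
Lemma end_level a L q s J A lv i : promotes k.+1 K' a -> promotes k.+1 a L -> i \in J ++ A ->
  L <= lv i -> st q s J A lv -> goal.
Proof.
move=> hF hF' iI Li [D [Qc [SQ [P [X [S [f [rho [c sD _]]]]]]]]]; have l := cf_link c.
have [h1 h2 h3 h4] := cf_dom c iI.
have iI' : i \in J ++ A ++ P by rewrite catA mem_cat iI.
have [D' [sD' pD' fD']] := hF' _ _ _ _ _ (cluster X S i) h3 (hits_leK Li (cf_lev c iI)) h2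
  (sub_cupr _ _) (sub_cupl _ _).
have [||Q' [s' p' f']] := hF D' w Qc u (cluster X S i) Sall _ (hits_le (leqnSn _) fD') (cf_Q c iI')
  (cf_all c iI').
- exact: link_sub sD' (sub_refl _) pD' (lk_posQ l) l.
- exact: sub_trans sD' (sub_trans sD sM).
exists Q'; split=> //; first exact: sub_trans s' (cf_subQ c).
exact: hits_le (leqnSn _) f'.
Qed.

(** [R] parts of [D] each take a slice of [k + 1] separating items and so carry trees of rank
    [k + 1]. The parts are shrunk to avoid one another's images, whence gathering applies. *)
Lemma end_sep R q s J A lv : gathers k.+1 K' R -> R * k.+1 <= s -> st q s J A lv -> goal.
Proof.
move=> hE Rs [D [Qc [SQ [P [X [S [f [rho [c sD szP]]]]]]]]]; have l := cf_link c.
have mP i : i \in P -> i \in J ++ A ++ P by move=> h; rewrite !mem_cat h !orbT.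
have uP : uniq P by have := cf_uniq c; rewrite !cat_uniq => /and3P[_ _ /and3P[]].
have [Dp [hD dD]] := split_parts R (lk_pos l) (lk_small l).
pose tr := [seq x <- [seq (st, i) | st <- [seq (a, b) | a <- iota 0 R, b <- iota 0 R], i <- P]
  | x.1.1 != x.1.2].
have [||Dq [hq aq]] := @parts_shrink _ w D f P R tr Dp _ hD.
- by move=> i /(cf_sep c)[].
- move=> x; rewrite mem_filter => /andP[ne /allpairsP[[st i] /= [/allpairsP[[a b] /= [ha hb ->]] iP ex]]].
  by move: ha hb ne; rewrite ex !mem_iota /= !add0n.
pose Pt t := [seq nth 0 P (t * k.+1 + a) | a <- iota 0 k.+1].
have idx t a : t < R -> a < k.+1 -> t * k.+1 + a < size P.
  move=> tR ak; rewrite szP; apply: leq_trans Rs.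
  by apply: leq_trans (_ : t.+1 * k.+1 <= _); [rewrite mulSn addnC ltn_add2r|rewrite leq_mul2r tR orbT].
have memPt t i : t < R -> i \in Pt t -> exists2 a, a < k.+1 & i = nth 0 P (t * k.+1 + a).
  by move=> tR /mapP[a]; rewrite mem_iota /= add0n => ak ->; exists a.
have PtP t i : t < R -> i \in Pt t -> i \in P.
  by move=> tR /(memPt _ _ tR)[a ak ->]; apply: mem_nth; apply: idx.
have PtD s' t i j : s' < R -> t < R -> s' != t -> i \in Pt s' -> j \in Pt t -> i != j.
  move=> sR tR st /(memPt _ _ sR)[a ak ->] /(memPt _ _ tR)[b bk ->].
  rewrite nth_uniq ?idx //; apply: contra st => /eqP e; apply/eqP.
  have := congr1 (divn^~ k.+1) e; rewrite !divnMDl // !divn_small // !addn0.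
  by [].
have PtU t : t < R -> uniq (Pt t).
  move=> tR; rewrite map_inj_in_uniq ?iota_uniq // => a b; rewrite !mem_iota /= !add0n => ak bk.
  by move/eqP; rewrite nth_uniq ?idx // eqn_add2l => /eqP.
pose Xt t i := img (f i) (Dq t).
pose St t := bigicup (Pt t) (cluster (Xt t) S).
have sDq t : t < R -> sub (Dq t) D.
  by move=> tR; apply: sub_trans (proj1 (hq t tR)) (proj1 (hD t tR)).
have sXt t i : t < R -> i \in P -> sub (Xt t i) (X i).
  move=> tR /(cf_sep c)[h _]; apply: img_sub.
  by apply: into_sub (sDq t tR) (sub_refl _) (st_into h).
have sClt t i : t < R -> i \in P -> sub (cluster (Xt t) S i) (cluster X S i).
  by move=> tR iP; apply/cluster_sub/sXt.
have hit t i : t < R -> i \in P -> sparseHit k w (Dq t) (Xt t i) (S i) (f i).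
  move=> tR iP; have [[h1 h2 h3 h4 h5 h6] _] := cf_sep c iP.
  have sd := sDq t tR; have sx := sXt t i tR iP; split.
  - exact: ready_sub sx (sub_refl _) h1.
  - exact: anti_subl sd h2.
  - exact: dis_sub sd sx h3.
  - by apply: into_img (sub_refl _) _; apply: into_sub sd (sub_refl _) h4.
  - exact: smallr_sub sx sd h5.
  - exact: sparse_sub sx sd h6.
have rdy t : t < R -> ready k.+1 (Dq t) (St t).
  move=> tR; apply: (@ready_hits _ k _ (size (Pt t)) w).
  - by rewrite size_map size_iota.
  - by [].
  - apply: (bigicup_hits (f := f) (PtU t tR)) => [i /(PtP _ _ tR)|i j /(PtP _ _ tR) iP /(PtP _ _ tR) jP ij].
      exact: hit.
    exact: anti_sub (sClt t i tR iP) (sClt t j tR jP) (cf_pair c (mP _ iP) (mP _ jP) ij).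
have [|||||Q' [s' p' f']] := hE D w Qc u Dq St Sall (iota 0 R) l.
- exact: sub_trans sD sM.
- exact: iota_uniq.
- by rewrite size_iota.
- move=> t; rewrite mem_iota /= add0n => tR; split.
  + exact: sDq.
  + exact: (proj2 (hq t tR)).
  + exact: rdy.
  + apply: bigicup_anti => i /(PtP _ _ tR) iP.
    exact: anti_subr (sClt t i tR iP) (cf_Q c (mP _ iP)).
  + apply: bigicup_sub => i /(PtP _ _ tR) iP.
    exact: sub_trans (sClt t i tR iP) (cf_all c (mP _ iP)).
- move=> a b; rewrite !mem_iota /= !add0n => aR bR ab; split.
  + apply: dis_sub (proj1 (hq a aR)) (proj1 (hq b bR)) (dD a b aR bR _).
    exact/eqP.
  + apply: bigicup_anti => i /(PtP _ _ bR) iP; apply: anti_cupr.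
      apply/anti_sym/img_anti.
      apply: (aq (b, a, i)); rewrite mem_filter /= eq_sym ab /=.
      apply/allpairsP; exists ((b, a), i); split=> //=.
      by apply/allpairsP; exists (b, a); rewrite /= !mem_iota /= !add0n aR bR.
    by apply: anti_subl (sDq a aR) _; have [[]] := cf_sep c iP.
  + apply: bigicup_anti => j jP; apply/anti_sym/bigicup_anti => i iP.
    apply: anti_sub (sClt _ _ bR (PtP _ _ bR jP)) (sClt _ _ aR (PtP _ _ aR iP)) _.
    apply: (cf_pair c (mP _ (PtP _ _ bR jP)) (mP _ (PtP _ _ aR iP))).
    by apply: (PtD b a) => //; rewrite eq_sym.
by exists Q'; split=> //; apply: sub_trans s' (cf_subQ c).
Qed.

(* The potential is the sum of [c ^ lv i] over the pool, with [c = 2k + 2].  As the pool items of lowest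
   level are spent, a hit on a pool item does not decrease it; every other outcome uses up part of the
   first factor on the left, which is a bounded budget. *)
Lemma descent a L R : promotes k.+1 K' a -> 0 < a -> promotes k.+1 a L -> gathers k.+1 K' R ->
  forall z q s J A lv, size J <= z -> st q s J A lv ->
  (K' - q + (R * k.+1 - s) + (2 * a * L.+1 - \sum_(i <- A) (lv i).+1)).+1 *
    ((2 * k).+1 * (2 * k).+2 ^ L) <= \sum_(i <- J) (2 * k).+2 ^ lv i -> goal.
Proof.
move=> hF a0 hF' hE; set c := (2 * k).+2; set W := _ * c ^ L.
have c0 : 0 < c by [].
have W0 : 0 < W by rewrite muln_gt0 expn_gt0.
elim=> [|z IH] q s J A lv.
  rewrite leqn0 size_eq0 => /eqP-> _; rewrite big_nil leqn0 muln_eq0 /=.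
  by rewrite -leqn0 leqNgt W0.
move=> sz hst bd.
case: (leqP K' q) => [|qK]; first exact: end_exit hst.
case: (leqP (R * k.+1) s) => [h|sR]; first exact: end_sep hE h hst.
case: (leqP (2 * a) (size A).+1) => [h|Aa]; first exact: end_dom hF a0 h hst.
case: (boolP (has (fun i => L <= lv i) (J ++ A))) => [/hasP[i iI Li]|/hasPn lvL].
  exact: end_level hF hF' iI Li hst.
have {}lvL i : i \in J ++ A -> lv i < L by move=> /lvL; rewrite ltnNge.
have uA : uniq A.
  have [D [Qc [SQ [P [X [S [f [rho [cc _ _]]]]]]]]] := hst.
  by have := cf_uniq cc; rewrite !cat_uniq => /and3P[_ _ /and3P[]].
(* There are fewer than [2 a] items in [A], all of level below [L]; thus the truncated subtraction
   in the budget really drops when this sum grows. *)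
have sumA : \sum_(i <- A) (lv i).+1 < 2 * a * L.+1.
  apply: (@leq_ltn_trans (size A * L.+1)); last by rewrite ltn_mul2r /=; apply: ltnW.
  rewrite -sum1_size big_distrl /= big_seq [leqRHS]big_seq; apply: leq_sum => i iA.
  by rewrite mul1n ltnW // ltnS lvL // mem_cat iA orbT.
pose le := [rel i j | lv i <= lv j].
pose J0 := sort le J; pose J1 := take (2 * k).+1 J0; pose J2 := drop (2 * k).+1 J0.
have pJ : perm_eq (J1 ++ J2) J by rewrite cat_take_drop perm_sort.
have sumJ : \sum_(i <- J) c ^ lv i <= size J * c ^ L.
  rewrite -sum1_size big_distrl /= big_seq [leqRHS]big_seq; apply: leq_sum => i iJ.
  by rewrite mul1n leq_exp2l // ltnW // lvL // mem_cat iJ.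
(* With all levels below [L], a potential of at least [W] forces [2k + 1] items in the pool. *)
have szJ : (2 * k).+1 <= size J.
  have h : W <= size J * c ^ L.
    by apply: leq_trans sumJ; apply: leq_trans bd; rewrite leq_pmull.
  by move: h; rewrite /W leq_mul2r expn_eq0 /=.
have sz1 : size J1 = (2 * k).+1 by rewrite size_take size_sort; case: ifP => //; lia.
have sz2 : size J2 <= z by rewrite size_drop size_sort; lia.
have mJ : J1 ++ J2 =i J by apply: perm_mem.
have ord i j : i \in J1 -> j \in J2 -> lv i <= lv j.
  have : sorted le (J1 ++ J2).
    by rewrite cat_take_drop; apply: sort_sorted => a1 b1; apply: leq_total.
  have tr : transitive le by move=> y x t /=; apply: leq_trans.
  by rewrite sorted_pairwise // pairwise_cat => /andP[/allrelP h _]; apply: h.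
pose Psi (J : seq nat) (lv : nat -> nat) := \sum_(i <- J) c ^ lv i.
have PsiJ : Psi J lv = Psi J1 lv + Psi J2 lv by rewrite /Psi -big_cat /=; apply/esym/perm_big.
have Psi1 (V : nat) : (forall i, i \in J1 -> c ^ lv i <= V) -> Psi J1 lv <= (2 * k).+1 * V.
  move=> h; rewrite -sz1 -sum1_size big_distrl /= /Psi big_seq [leqRHS]big_seq.
  by apply: leq_sum => i /h; rewrite mul1n.
have PsiW : Psi J1 lv <= W.
  apply: Psi1 => i iJ; rewrite leq_exp2l // ltnW // lvL // mem_cat -mJ mem_cat iJ //.
(* Spending [J1] costs at most [W], which one unit of budget pays for. *)
have drop1 b b' lv' : b' < b -> Psi J2 lv <= Psi J2 lv' -> b.+1 * W <= Psi J lv -> b'.+1 * W <= Psi J2 lv'.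
  move=> hb h1; rewrite PsiJ mulSn => h2; apply: leq_trans h1.
  have : b'.+1 * W <= b * W by rewrite leq_mul2r hb orbT.
  by move: PsiW h2; lia.
have Psi_z x : x \notin J2 ++ A -> Psi J2 (upd lv x 0) = Psi J2 lv.
  rewrite mem_cat negb_or => /andP[xJ _]; apply: eq_big_seq => i iJ.
  by rewrite upd_neq //; apply: contraNneq xJ => <-.
have A_z x : x \notin J2 ++ A -> \sum_(i <- A) (upd lv x 0 i).+1 = \sum_(i <- A) (lv i).+1.
  rewrite mem_cat negb_or => /andP[_ xA]; apply: eq_big_seq => i iA.
  by rewrite upd_neq //; apply: contraNneq xA => <-.
case: (config_step sM hst pJ sz1) => [h|[h0 hI h]|[x [xI [h|h]]]]; apply: (IH _ _ _ _ _ sz2 h).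
- by apply: drop1 bd => //; lia.
- have eA : \sum_(i <- A) (upd lv h0 (lv h0).+1 i).+1 = \sum_(i <- A) (lv i).+1 + (h0 \in A).
    rewrite -(sum_upd _ _ uA); apply: eq_bigr => i _.
    by rewrite /upd; case: eqP => [->|].
  have up i : c ^ lv i <= c ^ upd lv h0 (lv h0).+1 i.
    by rewrite /upd; case: eqP => [->|_] //; rewrite leq_exp2l.
  have upJ : Psi J2 lv <= Psi J2 (upd lv h0 (lv h0).+1) by apply: leq_sum => i _.
  rewrite eA; case: (boolP (h0 \in A)) => hA; first by apply: drop1 bd => //; lia.
  (* The budget is unchanged here. The hit item gains [(2k + 1) * c ^ lv h0], which covers the loss
     of [2k + 1] items of no higher level; this fixes [c = 2k + 2]. *)
  rewrite addn0; apply: leq_trans bd _; rewrite -/(Psi J lv) -/(Psi J2 _) PsiJ.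
  have hJ : h0 \in J2 by move: hI; rewrite mem_cat (negPf hA) orbF.
  have h1 : Psi J1 lv <= (2 * k).+1 * c ^ lv h0.
    by apply: Psi1 => i iJ; rewrite leq_exp2l // ord.
  rewrite /Psi !(big_rem h0 hJ) /= updE expnS.
  have h2 : \sum_(y <- rem h0 J2) c ^ lv y <= \sum_(y <- rem h0 J2) c ^ upd lv h0 (lv h0).+1 y.
    by apply: leq_sum.
  have arith p x y y' : x <= (2 * k).+1 * p -> y <= y' -> x + (p + y) <= (2 * k).+2 * p + y'.
    by rewrite (mulSn (2 * k).+1); lia.
  exact: arith h1 h2.
- by apply: drop1 bd; rewrite ?A_z ?Psi_z //; lia.
- by apply: drop1 bd; rewrite ?big_cons ?A_z ?Psi_z ?updE //; lia.
Qed.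
End Ends.

(** Either enough hits are separating for [end_sep], or the pool is large. All levels are 0 at the
    start, so the potential is the size of the pool, which is chosen to pay for the entire
    budget. *)
Lemma promote_step k : (forall K', promotable k.+1 K') -> (forall K', gatherable k.+1 K') -> forall K', promotable k K'.
Proof.
move=> hF hE K'; have [a0 hFa] := hF K'; have hF1 := promotes_mono (leqnSn _) hFa.
have [L hF2] := hF a0.+1; have [R hE1] := hE K'.
exists (R * k.+1 + (K' + R * k.+1 + 2 * a0.+1 * L.+1).+1 * ((2 * k).+1 * (2 * k).+2 ^ L)).
move=> M w Q u S Sall l fK aQ sS sM.
have [D [J [P [X [S' [f [rho [lv [c sD szK lv0]]]]]]]]] := config_init l fK aQ.
have hst : state k w u Q Sall M 0 (size P) J [::] lv.
  by exists D, Q, inil, P, X, S', f, rho; split=> //; apply: config_all c.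
case: (leqP (R * k.+1) (size P)) => [h|h]; first exact: (end_sep sM hE1 h hst).
apply: (descent sM hF1 _ hF2 hE1 (leqnn _) hst) => //.
rewrite big_nil !subn0 [leqRHS](eq_big_seq (fun=> 1)); last by move=> i /lv0->.
rewrite sum1_size.
apply: (@leq_trans ((K' + R * k.+1 + 2 * a0.+1 * L.+1).+1 * ((2 * k).+1 * (2 * k).+2 ^ L))).
  by rewrite leq_mul2r; apply/orP; right; lia.
by rewrite -(leq_add2r (size P)) szK addnC leq_add2r ltnW.
Qed.

(** * Climbing to the top rank *)

Section Climb.
Variable H : nat.
Hypothesis no_tree : forall n x (S : {set ver n}), ~ tree (edg n) H x S.

Lemma ready_false w M S : pos w M -> ready H M S -> False.
Proof. by move=> /pos_inh[n [x xM]] /(_ n x xM)[S0 _]; apply: no_tree. Qed.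

Lemma hits_false w M S : pos w M -> hits H 1 w M S -> False.
Proof.
move=> /pos_inh[n [x xM]] [S1 [X [SX [f [_ h _ _ _]]]]].
have [fX _] := st_into h xM.
by have [S0 _] := st_ready h fX; apply: no_tree.
Qed.

(** At rank [H] both statements are vacuous, because a positive set is nonempty and no vertex
    carries a tree of rank [H]. *)
Lemma promote_gather j : j <= H -> (forall K', promotable (H - j) K') /\ (forall K', gatherable (H - j) K').
Proof.
elim: j => [|j IH] jH.
  rewrite subn0; split=> K'; exists 1.
    by move=> M w Q u S Sall l h; case: (hits_false (lk_pos l) h).
  move=> M w Q u Mi Si Sall [|i I] // _ _ _ _ h _.
  by have [_ p rd _ _] := h i (mem_head _ _); case: (ready_false p rd).
have [hF hE] := IH (ltnW jH).
have e : H - j = (H - j.+1).+1 by rewrite subnSK.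
rewrite e in hF hE; have hF' := promote_step hF hE.
by split=> //; apply: gather_step.
Qed.

Definition one : iwt := fun n x => 1.
Definition full : iset := fun n => setT.
Hypotheses (pos_full : pos one full) (small_full : smallr full one full).
Hypothesis coherent : forall A B, pos one A -> pos one B -> ~ anti A B.

Lemma sub_full D : sub D full. Proof. by move=> n; apply: subsetT. Qed.

(** What [Z] fails to dominate is anticomplete to [Z], hence infinitesimal by coherence. *)
Lemma link_one D Q : dis D Q -> pos one D -> pos one Q -> link one D one Q.
Proof.
have sm A B : smallr A one B := smallr_sub (@sub_full A) (@sub_full B) small_full.
move=> d pD pQ; split=> // Z _ pZ pN; apply: (coherent pN pZ); exact: anti_dif.
Qed.

(** Rank 0 is gathered from arbitrary disjoint parts, single vertices being trees of rank 0. To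
    climb, [two_sides] gives a set with hits and a disjoint one that avoids them; coherence links
    the two, and promotion applies. *)
Lemma climb k K : k <= H -> exists D S, pos one D /\ hits k K one D S.
Proof.
have sm A : smallr A one A := smallr_sub (@sub_full A) (@sub_full A) small_full.
elim: k K => [|k IH] K kH.
  have [_] := promote_gather (leqnn H); rewrite subnn => /(_ K)[N hE].
  have [D1 [D2 [_ _ p1 p2 d12]]] := split_half pos_full small_full.
  have [Dp [h1 h2]] := split_parts N p1 (sm D1).
  have [||||Q' [_ p f]] := hE D1 one D2 one Dp (fun=> inil) full (iota 0 N) (link_one d12 p1 p2)
    (@sub_full _).
  - exact: iota_uniq.
  - by rewrite size_iota.
  - move=> i; rewrite mem_iota /= add0n => /h1[si pi]; split=> //.
    + exact: ready0.
    + exact: anti_nil.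
    + exact: sub_nil.
  - move=> i j; rewrite !mem_iota /= !add0n => iN jN /eqP ij; split; [exact: h2|exact: anti_nil|exact: anti_nil].
  by exists Q', full.
have [hF _] := promote_gather (leq_subr k H); rewrite subKn ?(ltnW kH) // in hF.
have [K0 hK0] := hF K; have {hK0}hK := promotes_mono (leqnSn _) hK0.
have [D [S [pD fD]]] := IH (2 * K0.+1) (ltnW kH).
have [D1 [D2 [s1 s2 p1 p2 d12]]] := split_half pD (sm D).
have [|A [B [SA [sAB [pA pB] fA _ aB]]]] :=
  two_sides (a := K0.+1) isT _ (hits_coverHits fD) s1 s2 p1 p2; first exact: leqnSn.
have dAB : dis A B.
  by case: sAB => [[a b]|[a b]]; [apply: dis_sub a b d12|apply/dis_sym/(dis_sub b a d12)].
have [Q' [_ p f]] := hK A one B one SA full (link_one dAB pA pB) fA aB (@sub_full _) (@sub_full _).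
by exists Q', full.
Qed.

Lemma no_coherent_sequence : False.
Proof. by have [D [S [p f]]] := climb 1 (leqnn H); apply: hits_false p f. Qed.
End Climb.
End Final.

(** * From the limit back to finite graphs *)

Lemma ultra_exists : exists large, ultra large.
Proof.
have [F [FU Finf]] := filter.ultraFilterLemma filter.eventually_filter.
exists F; split.
- by move=> P Q p q; apply: filter.filterI.
- by move=> P Q h p; apply: filter.filterS p.
- by move=> P; apply: (filter.in_ultra_setVsetC P FU).
- exact: filter.filter_not_empty.
- by move=> k; apply: Finf; exists k.
Qed.

Section Sequence.
Variables (T : nat -> finType) (e : forall n, rel (T n)) (H : nat).
Arguments e n : clear implicits.
Hypothesis simple : forall n, simple_graph (e n).
Hypothesis size_gt1 : forall n, 1 < #|T n|.
Hypothesis degree_lt : forall n x, degree (e n) x * n.+1 < #|T n|.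
Hypothesis coherent : forall n (A B : {set T n}), anticomplete (e n) A B ->
  #|T n| <= n.+1 * #|A| -> #|T n| <= n.+1 * #|B| -> False.

Arguments simple n : clear implicits.
Arguments size_gt1 n : clear implicits.

(** In a smaller graph all degrees would be 0, and two single vertices would form a forbidden
    anticomplete pair. This makes single vertices infinitesimal. *)
Lemma size_gt n : n.+1 < #|T n|.
Proof.
rewrite ltnNge; apply/negP=> hT.
have deg0 x y : e n x y = false.
  apply/negP=> exy; have := leq_trans (degree_lt x) hT.
  rewrite -[leqRHS]mul1n ltn_mul2r /= ltnNge => /negP; apply; apply/card_gt0P.
  by exists y; rewrite inE.
have /card_gt1P[x [y [_ _ xy]]] := size_gt1 n.
apply: (@coherent n [set x] [set y]); rewrite ?cards1 ?muln1 //.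
split=> [|a b _ _]; last by rewrite deg0.
by rewrite disjoints1 inE.
Qed.

Lemma some_tree : exists n x S, tree (e n) H x S.
Proof.
apply: contrapT => no; have [large Uu] := ultra_exists.
have sym n : symmetric (e n) by case: (simple n).
pose G := GraphSeq sym Uu.
have wt1 n (A : {set T n}) : wt (@one G n) A = #|A| by rewrite /wt sum1_card.
have tot1 n : tot (@one G) n = #|T n| by rewrite /tot wt1 cardsT.
apply: (@no_coherent_sequence G H).
- by move=> n x S h; apply: no; exists n, x, S.
- exists 2; apply: (ultra_all Uu) => n; rewrite tot1 wt1 cardsT.
  by have := size_gt n; lia.
(* The factor 2 leaves room for the vertex itself: both [k] and [k] times the degree are below half
   of the order of the graph. *)
- move=> k; apply: (ultra_imp Uu) (ultra_large Uu (2 * k)) => n kn y _; rewrite tot1 wt1.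
  have : #|nb (clo (e n)) [set y] :&: [set: T n]| <= (degree (e n) y).+1.
    rewrite setIT /degree -add1n -(cards1 y).
    apply: leq_trans (leq_card_setU _ _); apply: subset_leq_card.
    apply/subsetP=> z; rewrite in_nb1 !inE eq_sym; exact.
  have := degree_lt y; have := size_gt n.
  rewrite /full; move: (degree _ _) #|_| #|_| => d t c h1 h2 h3.
  have : 2 * (k * c) <= 2 * t; last by rewrite leq_mul2l.
  have : 2 * k * d <= n.+1 * d by rewrite leq_mul2r (leq_trans kn) ?orbT.
  have : k * c <= k * d.+1 by rewrite leq_mul2l h3 orbT.
  rewrite mulnS; lia.
- move=> A B [a pa] [b pb] aAB.
  have [n [ha [hb hn]]] := ultra_ex Uu (ultra_and Uu pa (ultra_and Uu pb (ultra_large Uu (a + b)))).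
  rewrite tot1 wt1 in ha; rewrite tot1 wt1 in hb.
  apply: (@coherent n (A n) (B n)).
  + split=> [|x y xA yB].
      rewrite disjoint_subset; apply/subsetP=> x xA; rewrite inE; apply/negP=> xB.
      by have := aAB n x x xA xB; rewrite clo_refl.
    by have := aAB n x y xA yB; rewrite /clo negb_or => /andP[].
  + by apply: leq_trans (ltnW ha) _; rewrite leq_mul2r; apply/orP; right; lia.
  + by apply: leq_trans (ltnW hb) _; rewrite leq_mul2r; apply/orP; right; lia.
Qed.
End Sequence.
Local Open Scope ring_scope.

Theorem theorem1p4 (TH : finType) (eH : rel TH) :
  simple_graph eH -> forest eH ->
  exists eps : rat, 0 < eps /\
    forall (T : finType) (e : rel T), simple_graph e ->
      (1 < #|T|)%N -> ~ contains e eH ->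
      (exists x : T, eps * (#|T|)%:R <= (degree e x)%:R) \/
      (exists A B : {set T}, anticomplete e A B /\
         eps * (#|T|)%:R <= (#|A|)%:R /\ eps * (#|T|)%:R <= (#|B|)%:R).
Proof.
move=> [hs hi] hf; apply: contrapT => no.
have ex (n : nat) : exists (T : finType) (e : rel T), [/\ simple_graph e, (1 < #|T|)%N,
    ~ contains e eH, forall x, (degree e x * n.+1 < #|T|)%N &
    forall A B : {set T}, anticomplete e A B ->
      (#|T| <= n.+1 * #|A|)%N -> (#|T| <= n.+1 * #|B|)%N -> False].
  apply: contrapT => nex; apply: no; exists n.+1%:R^-1.
  split=> [|T e sg T1 nc]; first by rewrite invr_gt0 ltr0n.
  have le_eps m : (n.+1%:R^-1 * #|T|%:R <= m%:R :> rat) = (#|T| <= n.+1 * m)%N.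
    by rewrite ler_pdivrMl ?ltr0n // -natrM ler_nat.
  apply: contrapT => nor; apply: nex; exists T, e; split=> // [x|A B aAB hA hB].
    rewrite ltnNge; apply/negP=> h; apply: nor; left; exists x.
    by rewrite le_eps mulnC.
  by apply: nor; right; exists A, B; rewrite !le_eps.
pose T n := projT1 (cid (ex n)); pose e n := projT1 (cid (projT2 (cid (ex n)))).
have he n := projT2 (cid (projT2 (cid (ex n)))).
have [|n|n x|n A B|n [x [S tS]]] := @some_tree T e #|TH|.
- by move=> n; case: (he n).
- by case: (he n).
- by case: (he n).
- by case: (he n) => _ _ _ _; apply.
case: (he n) => sg _ nc _ _; apply: nc; exact: (tree_contains hs hi hf sg tS).
Qed.
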